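(* For all $g\ge0$, $n\ge1$ and $(\mu_1,\dots,\mu_n)$ with $\mu_1\ge 2$... more precisely for every $(g,n)$ and every $\mu_1,\dots,\mu_n$ for which the left side is defined, the generalized Catalan numbers satisfy $$C_{g,n}(\mu_1,\dots,\mu_n)=\sum_{j=2}^n\mu_j\,C_{g,n-1}(\mu_1+\mu_j-2,\mu_2,\dots,\widehat{\mu_j},\dots,\mu_n)$$ $$+\sum_{\alpha+\beta=\mu_1-2}\Big[C_{g-1,n+1}(\alpha,\beta,\mu_2,\dots,\mu_n)+\sum_{\substack{g_1+g_2=g\\ I\sqcup J=\{2,\dots,n\}}}C_{g_1,|I|+1}(\alpha,\mu_I)\,C_{g_2,|J|+1}(\beta,\mu_J)\Big],$$ where $\alpha,\beta$ range over nonnegative integers, $\mu_I=(\mu_i)_{i\in I}$, and the last sum is over all $g_1,g_2\ge 0$ with $g_1+g_2=g$ and all ordered set partitions $(I,J)$ of $\{2,\dots,n\}$.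
   Context: A cellular graph of type $(g,n)$ is the 1-skeleton of a cell decomposition of a connected closed oriented surface of genus $g$ with $n$ vertices labeled by $\{1,\dots,n\}$, identified up to orientation-preserving homeomorphism respecting labels. $D_{g,n}(\mu_1,\dots,\mu_n)$ is the number of such graphs with vertex $i$ of degree $\mu_i$, each weighted by $1/|\mathrm{Aut}(\Gamma)|$. The generalized Catalan number is $C_{g,n}(\mu_1,\dots,\mu_n)=\mu_1\cdots\mu_n D_{g,n}(\mu_1,\dots,\mu_n)$ (a nonnegative integer, counting such graphs with an arrow placed on one incident half-edge at each vertex). Conventions: $C_{0,1}(0)=1$; $C_{g,n}(\mu)=0$ whenever some $\mu_i=0$ in all other cases; and $C_{g,n}=0$ if $g<0$.
   Formalization: The identity is stated for all μ_i ≥ 1: with the convention C_{0,1}(0)=1 it fails at μ_1=0 (for g=0, n=1 the left side is 1 and the right side 0); if μ_1 ≥ 1 and another μ_j=0, both sides are trivially 0. *)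

(* Defs.v *)
From mathcomp Require Import all_boot.
From mathcomp Require Import all_algebra.
Set Implicit Arguments. Unset Strict Implicit. Unset Printing Implicit Defensive.

(* Encoding of arrowed cellular graphs as combinatorial maps.
   Given degrees mu = [:: mu_1; ...; mu_n], the half-edges are 0 .. N-1,
   N = sumn mu; vertex i (0-based) owns the block of half-edges
   [offset i, offset (i+1)), listed in cyclic (counterclockwise) order
   starting from the arrowed half-edge.  The vertex rotation sigma is the
   cyclic shift inside each block.  An arrowed cellular graph is then the
   same as a fixed-point-free involution iota (the edges) such that
   <sigma, iota> acts transitively (connected surface); the faces are the
   cycles of sigma o iota, and the genus is given by Euler's formula
   n - E + F = 2 - 2g with E = N/2. *)

Definition offset (mu : seq nat) (i : nat) : nat := sumn (take i mu).

Definition vert_of (mu : seq nat) (h : nat) : nat :=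
  count (fun i => offset mu i.+1 <= h) (iota 0 (size mu)).

Definition rot (mu : seq nat) (h : nat) : nat :=
  let v := vert_of mu h in
  if h.+1 < offset mu v.+1 then h.+1 else offset mu v.

Definition sigma_ord (mu : seq nat) (h : 'I_(sumn mu)) : 'I_(sumn mu) :=
  insubd h (rot mu h).

Definition cellular_maps (g : nat) (mu : seq nat)
  : {set {ffun 'I_(sumn mu) -> 'I_(sumn mu)}} :=
  [set e : {ffun 'I_(sumn mu) -> 'I_(sumn mu)} |
    [&& [forall h, e (e h) == h],
        [forall h, e h != h],
        [forall x, forall y,
           connect [rel a b | (b == sigma_ord a) || (b == e a)] x y] &
        size mu + fcard (fun h => sigma_ord (e h)) predT + g.*2
          == 2 + (sumn mu)./2 ] ].

(* generalized Catalan number C_{g,n}(mu), n = size mu, g >= 0,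
   with the conventions C_{0,1}(0) = 1 and C_{g,n}(mu) = 0 if some mu_i = 0
   otherwise. *)
Definition Catalan (g : nat) (mu : seq nat) : nat :=
  if mu == [:: 0] then (g == 0 : nat)
  else if (mu == [::]) || (0 \in mu) then 0
  else #|cellular_maps g mu|.

Definition CatalanZ (g : int) (mu : seq nat) : nat :=
  match g with Posz g' => Catalan g' mu | Negz _ => 0 end.

(* Main.v *)
Require Import Defs.
From mathcomp Require Import all_boot all_algebra all_fingroup zify.
Import fingraph.
Set Implicit Arguments. Unset Strict Implicit. Unset Printing Implicit Defensive.

(* Add to each vertex a marker, a half-edge fixed by the edge involution and
   placed just before the arrow.  A map is then a pair (s, e) of a rotation s,
   given by the list of its cycles with the marker as head of each list, and
   an involution e whose moved points are exactly the darts.  Markers absorb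
   the conventions on vertices of degree 0: such a vertex is a lone marker.

   Let x be the first dart of the first vertex, h = e x and t = (x h).
   Replacing (s, e) by (t s, t e) keeps the product, hence the faces; it turns
   x and h into fixed points of the involution, and t s either merges the
   cycles of x and h (first sum of the recursion) or splits their common cycle
   (second sum, h becoming the marker of the new vertex).  On the partition
   generated by the two permutations, the inverse operation adds the edge x-h,
   so a split map has one or two components.  Points that are neither darts nor
   alone in their cycle can then be deleted without changing the genus.

   That genera are natural numbers (needed to distribute g over two components,
   and to discard the connected split when g = 0) is proved by inserting the
   edges one at a time. *)

Import GroupScope.
Local Open Scope nat_scope.

(** * Connectivity and the number of components of a finite relation *)

Section Relations.
Variable T : finType.
Implicit Types (r : rel T) (A : {set T}).

(** Each component has exactly one root, so the image of [f] is already the image of the roots.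
    Components can thus be counted by any convenient complete invariant. *)
Lemma n_comp_kernel (U : finType) (f : T -> U) r :
  (forall a b, (f a == f b) = connect r a b) -> n_comp r T = #|f @: T|.
Proof.
move=> fE; have rsym : connect_sym r by move=> a b; rewrite -!fE eq_sym.
have -> : f @: T = f @: [set x | roots r x].
  apply/setP => u; apply/imsetP/imsetP => -[x _ ->]; last by exists x.
  exists (root r x); first by rewrite inE roots_root.
  by apply/eqP; rewrite fE connect_root.
rewrite card_in_imset; first by apply: eq_card => x; rewrite !inE andbT.
move=> x y; rewrite !inE => /eqP xr /eqP yr /eqP.
by rewrite fE => /(rootP rsym); rewrite xr yr.
Qed.

Lemma connect_sym_step r :
  (forall a b, r a b -> connect r b a) -> connect_sym r.
Proof.
move=> H; suff S a b : connect r a b -> connect r b a by move=> a b; apply/idP/idP; apply: S.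
case/connectP=> p; elim: p a => [|c p IH] a /=; first by move=> _ ->.
case/andP=> /H ca /IH{}IH /IH bc; exact: connect_trans bc ca.
Qed.

Lemma connect_ind_closed r (P : pred T) a b :
  (forall x y, P x -> r x y -> P y) -> connect r a b -> P a -> P b.
Proof.
move=> H /connectP[p]; elim: p a => [|c p IH] a /=; first by move=> _ ->.
by case/andP=> ac pc lb Pa; apply: (IH c) => //; apply: H ac.
Qed.

(** A path that starts in [A] never leaves it, so only the edges out of points of [A] matter. *)
Lemma eq_connect_on r1 r2 A a b :
  (forall x y, x \in A -> r1 x y = r2 x y) ->
  (forall x y, x \in A -> r1 x y -> y \in A) ->
  a \in A -> connect r1 a b = connect r2 a b.
Proof.
move=> r12 Acl Aa; apply/idP/idP => H.
- have : (b \in A) && connect r2 a b.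
    apply: (connect_ind_closed (P := fun y => (y \in A) && connect r2 a y)) H _; last by rewrite Aa /=.
    move=> x y /andP[Ax ax] xy; rewrite (Acl x) //=.
    by apply: connect_trans ax (connect1 _); rewrite -r12.
  by case/andP.
- have : (b \in A) && connect r1 a b.
    apply: (connect_ind_closed (P := fun y => (y \in A) && connect r1 a y)) H _; last by rewrite Aa /=.
    move=> x y /andP[Ax ax]; rewrite -r12 // => xy; rewrite (Acl x) //=.
    by apply: connect_trans ax (connect1 _).
  by case/andP.
Qed.

(** Connectivity after one undirected edge is added: a path can be shortened so that it crosses the
    new edge at most once, in one direction or the other. *)
Definition add_edge r (x y : T) : rel T :=
  [rel a b | [|| connect r a b, connect r a x && connect r y b
                | connect r a y && connect r x b]].

Lemma connect_add_edge r r' x y :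
  connect_sym r -> connect_sym r' ->
  subrel r (connect r') -> connect r' x y -> subrel r' (add_edge r x y) ->
  connect r' =2 add_edge r x y.
Proof.
move=> rS rS' rr' xy r'r a b; apply/idP/idP.
- move=> H; apply: (connect_ind_closed (P := add_edge r x y a)) H _; last by rewrite /add_edge /= connect0.
  move=> c d /or3P[] ac /r'r /or3P[] cd; apply/or3P.
  + by apply: Or31; apply: connect_trans cd.
  + by case/andP: cd => cx ->; apply: Or32; rewrite (connect_trans ac).
  + by case/andP: cd => cx ->; apply: Or33; rewrite (connect_trans ac).
  + by case/andP: ac => -> yc; apply: Or32; rewrite (connect_trans yc).
  + case/andP: ac => ax yc; case/andP: cd => cx yd.
    by apply: Or31; apply: connect_trans ax (connect_trans _ yd); rewrite rS (connect_trans yc).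
  + case/andP: ac => ax yc; case/andP: cd => cy xd.
    by apply: Or31; apply: connect_trans ax xd.
  + by case/andP: ac => -> yc; apply: Or33; rewrite (connect_trans yc).
  + by case/andP: ac => ay xc; case/andP: cd => cx yd; apply: Or31; apply: connect_trans ay yd.
  + case/andP: ac => ay xc; case/andP: cd => cy xd.
    by apply: Or31; apply: connect_trans ay (connect_trans _ xd); rewrite rS (connect_trans xc).
- have sub := connect_sub rr'.
  case/or3P=> [/sub //|/andP[/sub ax /sub yb]|/andP[/sub ay /sub xb]].
    by apply: connect_trans ax (connect_trans xy yb).
  by apply: connect_trans ay (connect_trans _ xb); rewrite rS'.
Qed.

Lemma n_comp_add_edge r r' x y :
  connect_sym r -> connect r' =2 add_edge r x y ->
  n_comp r T = n_comp r' T + ~~ connect r x y.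
Proof.
move=> rS r'E; case: (boolP (connect r x y)) => xy /=.
  rewrite addn0; apply: eq_n_comp => a b; rewrite r'E /add_edge /=.
  apply/idP/idP => [-> //|/or3P[//|/andP[ax yb]|/andP[ay xb]]].
    by apply: connect_trans ax (connect_trans xy yb).
  by apply: connect_trans ay (connect_trans _ xb); rewrite rS.
rewrite (n_comp_kernel (f := root r)); last exact: root_connect.
(* A complete invariant of the enlarged relation: the component of [y] is sent to the root of [x],
   so only [root r y] drops out of the image. *)
pose f a := if connect r a y then root r x else root r a.
have fE a b : (f a == f b) = connect r' a b.
  rewrite r'E /add_edge /f /=; case: (boolP (connect r a y)) => ay.
    case: (boolP (connect r b y)) => byy.
      by rewrite eqxx (connect_trans ay) // rS.
    rewrite root_connect //= (negPf (_ : ~~ connect r a b)) /=; last first.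
      by apply: contra byy => ab; rewrite -(same_connect rS ab).
    rewrite (negPf (_ : ~~ connect r a x)) // .
    by apply: contra xy => ax; rewrite -(same_connect rS ax).
  case: (boolP (connect r b y)) => byy; rewrite root_connect //= ?andFb ?orbF.
    rewrite (negPf (_ : ~~ connect r a b)) /=; last first.
      by apply: contra ay => ab; apply: connect_trans byy.
    by rewrite [connect r y b]rS byy andbT.
  by rewrite [connect r y b]rS (negPf byy) andbF orbF.
rewrite (n_comp_kernel fE).
have -> : f @: T = (root r @: T) :\ root r y.
  apply/setP => u; rewrite !inE; apply/imsetP/andP.
    case=> a _ ->; rewrite /f; case: ifP => ay; split.
    + by rewrite root_connect.
    + exact: imset_f.
    + by rewrite root_connect // ay.
    + exact: imset_f.
  case=> uy /imsetP[a _ ua]; exists a => //; rewrite /f ifN //.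
  by move: uy; rewrite ua root_connect.
by rewrite addn1 (cardsD1 (root r y)) imset_f.
Qed.

End Relations.

(** * Permutations, edge involutions and the genus of a pair *)

Section Perms.
Variable T : finType.
Implicit Types (s e p q t : {perm T}) (A D : {set T}).

(** Fixed points count as cycles. *)
Definition cyc s := #|porbits s|.

Lemma mem_porbit_fconnect s x y : (y \in porbit s x) = fconnect s x y.
Proof.
apply/porbitP/idP => [[i ->]|/iter_findex <-]; first by rewrite permX fconnect_iter.
by exists (findex s x y); rewrite permX.
Qed.

Lemma cyc_fcard s : cyc s = fcard s T.
Proof.
rewrite (n_comp_kernel (f := porbit s)) // => a b.
by rewrite eq_porbit_mem porbit_sym mem_porbit_fconnect.
Qed.

Lemma cyc1 : cyc (1 : {perm T}) = #|T|.
Proof.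
rewrite cyc_fcard -(@fcard_id T T); apply: eq_fcard => x; exact: perm1.
Qed.

Definition gen_rel s e : rel T := [rel a b | (b == s a) || (b == e a)].

Lemma fconnect_gen_rel s e u :
  (forall a, connect (gen_rel s e) a (u a)) -> subrel (fconnect u) (connect (gen_rel s e)).
Proof.
move=> H; apply: connect_sub => a b /= /eqP <-; exact: H.
Qed.

Lemma gen_rel_l s e a : connect (gen_rel s e) a (s a).
Proof. by apply: connect1; rewrite /gen_rel /= eqxx. Qed.

Lemma gen_rel_r s e a : connect (gen_rel s e) a (e a).
Proof. by apply: connect1; rewrite /gen_rel /= eqxx orbT. Qed.

(** On a finite set the inverse of a permutation is one of its powers, so each directed step can be
    undone by forward steps. *)
Lemma gen_rel_sym s e : connect_sym (gen_rel s e).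
Proof.
apply: connect_sym_step => a b /orP[]/eqP->.
  by apply: (fconnect_gen_rel (gen_rel_l s e)); rewrite fconnect_sym ?fconnect1 //; exact: perm_inj.
by apply: (fconnect_gen_rel (gen_rel_r s e)); rewrite fconnect_sym ?fconnect1 //; exact: perm_inj.
Qed.

Lemma porbit_gen_rel s e x y : y \in porbit (e * s) x -> connect (gen_rel s e) x y.
Proof.
rewrite mem_porbit_fconnect; apply: fconnect_gen_rel => a; rewrite permM.
exact: connect_trans (gen_rel_r _ _ _) (gen_rel_l _ _ _).
Qed.

Definition n_components s e := n_comp (gen_rel s e) T.

Definition involutions D :=
  [set e : {perm T} | [forall x, e (e x) == x] & [forall x, (e x != x) == (x \in D)]].

Lemma involutionsP D e :
  reflect ((forall x, e (e x) = x) /\ (forall x, (e x != x) = (x \in D)))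
          (e \in involutions D).
Proof.
rewrite inE; apply: (iffP andP) => -[h1 h2]; split; try apply/forallP => x; try move=> x.
- exact/eqP/(forallP h1).
- by rewrite (eqP (forallP h2 x)).
- by rewrite h1.
- by rewrite h2.
Qed.

Lemma involutions_fix D e x : e \in involutions D -> x \notin D -> e x = x.
Proof. by case/involutionsP=> _ /(_ x) H; rewrite -H negbK => /eqP. Qed.

(** Left multiplication by the transposition erases the edge joining [x] and [h], which become fixed
    points, or puts it back. This drives the induction on edges and the removal of the edge at the
    first dart. *)
Lemma involutions_tperm D e x h : x \in D -> h \in D -> x != h ->
  (e \in involutions D) && (e x == h)
    = ((tperm x h * e)%g \in involutions (D :\ x :\ h)).
Proof.
move=> Dx Dh xh; apply/andP/idP.
- case=> eI /eqP ex; case/involutionsP: (eI) => ee eD.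
  have eh : e h = x by rewrite -ex ee.
  have qx : (tperm x h * e)%g x = x by rewrite permM tpermL eh.
  have qh : (tperm x h * e)%g h = h by rewrite permM tpermR ex.
  have qz z : z != x -> z != h -> (tperm x h * e)%g z = e z.
    by move=> zx zh; rewrite permM tpermD // eq_sym.
  apply/involutionsP; split=> z.
    have [->|zx] := eqVneq z x; first by rewrite !qx.
    have [->|zh] := eqVneq z h; first by rewrite !qh.
    have ezx : e z != x by apply: contraNneq zh => zE; rewrite -[z]ee zE ex.
    have ezh : e z != h by apply: contraNneq zx => zE; rewrite -[z]ee zE eh.
    by rewrite (qz z) // qz // ee.
  rewrite !inE; have [->|zh] := eqVneq z h; first by rewrite qh eqxx.
  have [->|zx] := eqVneq z x; first by rewrite qx eqxx.
  by rewrite qz //= -eD.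
- set q := (_ * e)%g => qI; case/involutionsP: (qI) => qq qD.
  have eE : e = (tperm x h * q)%g by rewrite /q mulgA tperm2 mul1g.
  have qx : q x = x by apply/eqP; rewrite -[_ == _]negbK qD !inE eqxx /= andbF.
  have qh : q h = h by apply/eqP; rewrite -[_ == _]negbK qD !inE eqxx /=.
  have ex : e x = h by rewrite eE permM tpermL.
  have eh : e h = x by rewrite eE permM tpermR.
  have ez z : z != x -> z != h -> e z = q z.
    by move=> zx zh; rewrite eE permM tpermD // eq_sym.
  split; last by rewrite ex.
  apply/involutionsP; split=> z.
    have [->|zx] := eqVneq z x; first by rewrite ex.
    have [->|zh] := eqVneq z h; first by rewrite eh.
    have qzx : q z != x by apply: contraNneq zx => zE; rewrite -[z]qq zE qx.
    have qzh : q z != h by apply: contraNneq zh => zE; rewrite -[z]qq zE qh.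
    by rewrite (ez z) // ez // qq.
  have [->|zx] := eqVneq z x; first by rewrite ex Dx eq_sym.
  have [->|zh] := eqVneq z h; first by rewrite eh Dh.
  by rewrite ez // qD !inE zh zx.
Qed.

(* Multiplying both permutations by the same transposition does not change the
   product [e * s]; on the generated partition it adds the edge [x]--[h]. *)
Lemma connect_tperm_l s e x h :
  e x = h -> e h = x ->
  connect (gen_rel s e) =2 add_edge (gen_rel (tperm x h * s) (tperm x h * e)) x h.
Proof.
move=> ex eh; set p := (_ * s)%g; set q := (_ * e)%g.
have sE a : s a = p (tperm x h a) by rewrite /p permM tpermK.
have eE a : e a = q (tperm x h a) by rewrite /q permM tpermK.
have pS := gen_rel_sym p q.
apply: connect_add_edge => //; first exact: gen_rel_sym.
- move=> a b /orP[]/eqP->.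
    rewrite /p permM; apply: connect_trans (gen_rel_l _ _ _).
    by case: tpermP => [->|->|//]; [rewrite -ex|rewrite -eh]; rewrite gen_rel_r.
  rewrite /q permM; apply: connect_trans (gen_rel_r _ _ _).
  by case: tpermP => [->|->|//]; [rewrite -ex|rewrite -eh]; rewrite gen_rel_r.
- by rewrite -ex gen_rel_r.
- have H u a b : (forall c, connect (gen_rel p q) c (u c)) -> b = u (tperm x h a) ->
    add_edge (gen_rel p q) x h a b.
    move=> Hu ->; case: tpermP => [->|->|_ _].
    + by apply/or3P; apply: Or32; rewrite connect0 Hu.
    + by apply/or3P; apply: Or33; rewrite connect0 Hu.
    + by apply/or3P; apply: Or31; rewrite Hu.
  move=> a b /orP[]/eqP->.
    apply: (H p); [exact: gen_rel_l|exact: sE].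
  by apply: (H q); [exact: gen_rel_r|exact: eE].
Qed.

(** Only the edge involution changes here, the vertices stay; this is the form for inserting edges
    one at a time. *)
Lemma connect_tperm_r s e x h :
  e x = h -> e h = x ->
  connect (gen_rel s e) =2 add_edge (gen_rel s (tperm x h * e)) x h.
Proof.
move=> ex eh; set q := (_ * e)%g.
have eE a : e a = q (tperm x h a) by rewrite /q permM tpermK.
apply: connect_add_edge => //; try exact: gen_rel_sym.
- move=> a b /orP[]/eqP->; first exact: gen_rel_l.
  rewrite /q permM; apply: connect_trans (gen_rel_r _ _ _).
  by case: tpermP => [->|->|//]; [rewrite -ex|rewrite -eh]; rewrite gen_rel_r.
- by rewrite -ex gen_rel_r.
- move=> a b /orP[]/eqP->.
    by apply/or3P; apply: Or31; rewrite gen_rel_l.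
  rewrite eE; case: tpermP => [->|->|_ _].
  + by apply/or3P; apply: Or32; rewrite connect0 gen_rel_r.
  + by apply/or3P; apply: Or33; rewrite connect0 gen_rel_r.
  + by apply/or3P; apply: Or31; rewrite gen_rel_r.
Qed.

(** Were [x] and [h] still on different cycles, each of two multiplications by the transposition
    would lose a cycle, although together they give back [s]. *)
Lemma porbit_tperm_merge s x h :
  x \notin porbit s h -> x \in porbit (tperm x h * s) h.
Proof.
move=> xh; have nxh : x != h by apply: contraNneq xh => ->; rewrite porbit_id.
apply: contraT => H.
have := porbits_mul_tperm s x h; have := porbits_mul_tperm (tperm x h * s) x h.
rewrite /= mulgA tperm2 mul1g xh H nxh; lia.
Qed.

(* [k] is the sum of the genera of the components. *)
Lemma euler_genus s D e : e \in involutions D ->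
  exists k m, #|D| = m.*2 /\ cyc s + cyc (e * s) + k.*2 = (n_components s e).*2 + m.
Proof.
have [n] := ubnP #|D|; elim: n D e => // n IH D e leD eI.
have [D0|[x Dx]] := set_0Vmem D.
  have e1 : e = 1%g.
    by apply/permP=> z; rewrite perm1 (involutions_fix eI) // D0 inE.
  exists 0, 0; rewrite D0 cards0; split => //.
  rewrite e1 mul1g /n_components !addn0 addnn cyc_fcard; congr _.*2.
  apply: eq_n_comp => a b; apply/idP/idP.
    by apply: fconnect_gen_rel; exact: gen_rel_l.
  apply: connect_sub => c d /orP[]/eqP->; first exact: fconnect1.
  by rewrite perm1.
case/involutionsP: (eI) => ee eD.
set h := e x; have xh : x != h by rewrite eq_sym eD.
have eh : e h = x by rewrite /h ee.
have Dh : h \in D by rewrite -eD eh.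
have := involutions_tperm e Dx Dh xh; rewrite eI eqxx /= => /esym qI.
set q := (_ * e)%g in qI.
have cD : #|D| = #|D :\ x :\ h|.+2.
  by rewrite (cardsD1 x) Dx (cardsD1 h) !inE eq_sym xh Dh.
have [|k [m [Dm E]]] := IH _ _ _ qI; first by move: leD; rewrite cD; lia.
have cE := connect_tperm_r s (erefl (e x)) eh; rewrite -/h -/q in cE.
have := n_comp_add_edge (gen_rel_sym s q) cE; rewrite -/(n_components s q) -/(n_components s e) => compE.
have eqs : (e * s = tperm x h * (q * s))%g by rewrite !mulgA tperm2 mul1g.
have := porbits_mul_tperm (q * s) x h; rewrite /= -eqs xh -/(cyc _) -/(cyc _).
(* A face through both ends would connect them, so an edge between two components always merges two
   faces. *)
have : ~~ connect (gen_rel s q) x h -> x \notin porbit (q * s) h.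
  by apply: contra => /porbit_gen_rel; rewrite gen_rel_sym.
(* Inside a component the new edge either merges two faces, adding a handle, or splits a face and
   keeps the genus. Between two components it merges two faces and the genera add. *)
move: compE E; case: (connect _ x h); case: (x \notin _) => //= compE E H cycE; last by have := H isT.
- by exists k.+1, m.+1; rewrite cD Dm; split; lia.
- by exists k, m.+1; rewrite cD Dm; split; lia.
- by exists k, m.+1; rewrite cD Dm; split; lia.
Qed.

End Perms.

(** * Connected maps on a set of points, and the removal of a point or of an edge *)

Section Maps.
Variable T : finType.
Implicit Types (s e p q t : {perm T}) (A D : {set T}).

Lemma involutions_on A D e : e \in involutions D -> D \subset A -> perm_on A e.
Proof.
move=> eI DA; apply/subsetP => x; rewrite inE => ex.
by apply: (subsetP DA); case/involutionsP: eI => _ <-.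
Qed.

Definition conn A s e :=
  [forall x in A, forall y in A, connect (gen_rel s e) x y].

Lemma connP A s e :
  reflect {in A &, forall x y, connect (gen_rel s e) x y} (conn A s e).
Proof.
apply: (iffP forall_inP) => [H x y xA yA|H x xA]; first exact: (forall_inP (H x xA)).
by apply/forall_inP => y yA; apply: H.
Qed.

Lemma conn_base A s e a : a \in A -> {in A, forall y, connect (gen_rel s e) a y} -> conn A s e.
Proof.
move=> aA H; apply/connP => x y xA yA; apply: connect_trans (H y yA).
by rewrite gen_rel_sym H.
Qed.

(* Every point outside [A] is fixed by [s] and [e], so it is counted by both
   [cyc] terms; this is what [#|~: A|] compensates. *)
Definition euler A s D (g : nat) e :=
  cyc s + cyc (e * s) + g.*2 == (#|~: A|.+1).*2 + #|D|./2.

(** [A] holds all points and [D] the darts; points of [A] outside [D], such as markers, are fixed by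
    the involution. The ambient type stays the same while points and edges are removed. *)
Definition maps A s D g :=
  [set e in involutions D | conn A s e & euler A s D g e].

Lemma in_maps A s D g e :
  (e \in maps A s D g) = [&& e \in involutions D, conn A s e & euler A s D g e].
Proof. by rewrite inE. Qed.

Lemma n_components_conn A s e a : a \in A -> perm_on A s -> perm_on A e -> conn A s e ->
  n_components s e = #|~: A|.+1.
Proof.
move=> aA sA eA /connP cA.
(* All of [A] is one component, sent to [None]; every other point is a component by itself. *)
pose f x := if x \in A then None else Some x.
have closA x y : connect (gen_rel s e) x y -> x \in A -> y \in A.
  apply: (connect_ind_closed (P := fun z => z \in A)) => u v uA /orP[]/eqP->; by rewrite perm_closed.
have fE x y : (f x == f y) = connect (gen_rel s e) x y.
  rewrite /f; case: ifP => xA; case: ifP => yA.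
  - by rewrite eqxx cA.
  - by symmetry; apply/negbTE; apply: contraFN yA => /closA; apply.
  - by symmetry; apply/negbTE; apply: contraFN xA; rewrite gen_rel_sym => /closA; apply.
  - apply/eqP/idP => [[->] //|H]; congr Some; apply/eqP.
    apply: (connect_ind_closed (P := fun y => x == y)) H _ => // u v /eqP<-.
    by case/orP=> /eqP->; rewrite (@out_perm _ A) ?xA.
rewrite /n_components (n_comp_kernel fE).
have -> : f @: T = None |: Some @: ~: A.
  apply/setP => u; rewrite !inE; apply/imsetP/orP.
    case=> x _ ->; rewrite /f; case: ifP => xA; first by left.
    by right; apply: imset_f; rewrite inE xA.
  case=> [/eqP->|/imsetP[x]]; first by exists a => //; rewrite /f aA.
  by rewrite inE => xA ->; exists x => //; rewrite /f (negPf xA).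
rewrite cardsU1 card_imset; last by move=> ? ? [].
by case: (boolP (None \in _)) => // /imsetP[].
Qed.

Lemma conn_genus A s D e a :
  a \in A -> perm_on A s -> D \subset A -> e \in involutions D -> conn A s e ->
  exists k m, #|D| = m.*2 /\ cyc s + cyc (e * s) + k.*2 = (#|~: A|.+1).*2 + m.
Proof.
move=> aA sA DA eI cA; have [k [m [Dm E]]] := euler_genus s eI.
by exists k, m; split=> //; rewrite E (n_components_conn aA) // (involutions_on eI).
Qed.

(* The first-return permutation of [s] on the complement of [x]. *)
Definition del x s := (tperm x ((s^-1)%g x) * s)%g.

Lemma delE x s y :
  del x s y = if y == x then x else if s y == x then s x else s y.
Proof.
rewrite permM; case: tpermP => [->|->|/eqP/negbTE-> /eqP yx].
- by rewrite permKV eqxx.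
- rewrite permKV eqxx; case: eqP => // H; by rewrite -{1}H permKV.
- by rewrite ifN //; apply: contra yx => /eqP <-; rewrite permK.
Qed.

Lemma cyc_del x s : s x != x -> cyc (del x s) = (cyc s).+1.
Proof.
move=> sx; have := porbits_mul_tperm s x ((s^-1)%g x); rewrite /= -/(del x s) -/(cyc _) -/(cyc _).
have -> : x \in porbit s ((s^-1)%g x) by apply/porbitP; exists 1; rewrite expg1 permKV.
have -> : x != (s^-1)%g x by apply: contraNneq sx => xE; rewrite {1}xE permKV.
by rewrite /= addn0 addn1.
Qed.

(** The involution fixes [x], so bypassing [x] in the vertices also bypasses it in the faces. *)
Lemma mul_del x s e : e x = x -> (e * del x s)%g = del x (e * s).
Proof.
move=> ex; apply/permP => y; rewrite permM !delE !permM ex.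
by rewrite -{1}ex (inj_eq perm_inj).
Qed.

Lemma connect_del x s e a b : e x = x -> s x != x -> a != x -> b != x ->
  connect (gen_rel (del x s) e) a b = connect (gen_rel s e) a b.
Proof.
move=> ex sx ax bx; apply/idP/idP.
  apply: connect_sub => c d /orP[]/eqP->; last exact: gen_rel_r.
  rewrite delE; case: eqP => [->//|_]; case: eqP => [<-|_]; last exact: gen_rel_l.
  exact: connect_trans (gen_rel_l _ _ _) (gen_rel_l _ _ _).
(* [f] pushes [x] to its successor, so each step of the full relation becomes a path of the relation
   without [x]. *)
pose f z := if z == x then s x else z.
have fstep c d : gen_rel s e c d -> connect (gen_rel (del x s) e) (f c) (f d).
  case/orP=> /eqP->; rewrite /f.
    case: (eqVneq c x) => [->|cx]; first by rewrite (negPf sx).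
    have := delE x s c; rewrite (negPf cx); case: eqP => _ <-; exact: gen_rel_l.
  case: (eqVneq c x) => [->|cx]; first by rewrite ex eqxx.
  have -> : (e c == x) = (c == x) by rewrite -{1}ex (inj_eq perm_inj).
  by rewrite (negPf cx) gen_rel_r.
have -> : a = f a by rewrite /f (negPf ax).
have {2}-> : b = f b by rewrite /f (negPf bx).
have fa z : connect (gen_rel s e) a z -> connect (gen_rel (del x s) e) (f a) (f z).
  move=> az; apply: (connect_ind_closed (P := fun z => connect (gen_rel (del x s) e) (f a) (f z))) az _ => // u v fu /fstep.
  exact: connect_trans.
by rewrite {1}/f (negPf ax); apply: fa.
Qed.

Lemma card_setCD1 A x : x \in A -> #|~: (A :\ x)| = #|~: A|.+1.
Proof. by move=> xA; have := cardsC A; have := cardsC (A :\ x); rewrite (cardsD1 x A) xA; lia. Qed.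

(** Detaching [x] creates one cycle in the rotation and one in the face permutation, while one more
    point lies outside [A]: both sides of the Euler relation grow by two. *)
Lemma maps_del A s D g x :
  x \in A -> perm_on A s -> x \notin D -> s x != x ->
  maps A s D g = maps (A :\ x) (del x s) D g.
Proof.
move=> xA sA xD sx; apply/setP => e; rewrite !in_maps.
case: (boolP (e \in involutions D)) => //= eI.
have ex := involutions_fix eI xD.
have exs : (e * s)%g x != x by rewrite permM ex.
congr (_ && _).
  apply/connP/connP => H a b.
    by rewrite !inE => /andP[ax aA] /andP[bx bA]; rewrite connect_del //; exact: H.
  have sxA : s x \in A :\ x by rewrite !inE sx perm_closed.
  have toN c : c \in A -> exists2 c', c' \in A :\ x & connect (gen_rel s e) c c'.
    move=> cA; have [->|cx] := eqVneq c x; first by exists (s x) => //; exact: gen_rel_l.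
    by exists c; rewrite ?inE ?cx.
  move=> /toN[a' a'A aa'] /toN[b' b'A bb'].
  apply: connect_trans aa' _; rewrite gen_rel_sym; apply: connect_trans bb' _.
  by rewrite gen_rel_sym -(connect_del (x := x)) ?H //; [case/setD1P: a'A|case/setD1P: b'A].
by rewrite /euler mul_del // !cyc_del // card_setCD1 //; apply/eqP/eqP; lia.
Qed.

Lemma card_peel D x h (P : pred {perm T}) : x \in D -> h \in D -> x != h ->
  #|[set e in involutions D | (e x == h) && P e]|
    = #|[set q in involutions (D :\ x :\ h) | P (tperm x h * q)%g]|.
Proof.
move=> xD hD xh; rewrite -(card_preimset (f := mulg (tperm x h))); last exact: mulgI.
apply: eq_card => q; rewrite !inE andbA; congr (_ && _).
have := involutions_tperm (tperm x h * q) xD hD xh.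
by rewrite mulgA tperm2 mul1g ![_ \in involutions _]in_set.
Qed.

Lemma tperm_commute s x h : s x = h -> s h = x -> (tperm x h * s = s * tperm x h)%g.
Proof.
move=> sx sh; apply/permP => y; rewrite !permM.
case: tpermP => [->|->|/eqP yx /eqP yh]; first by rewrite sh sx tpermR.
  by rewrite sh sx tpermL.
by rewrite tpermD // eq_sym; [rewrite -sh|rewrite -sx]; rewrite (inj_eq perm_inj).
Qed.

(** The edge is a cycle of length two of [e], so the transposition commutes with [e] and its two
    copies cancel. *)
Lemma mul_peel s e x h : e x = h -> e h = x ->
  ((tperm x h * e) * (tperm x h * s) = e * s)%g.
Proof. by move=> ex eh; rewrite (tperm_commute ex eh) mulgA -(mulgA e) tperm2 mulg1. Qed.

Lemma involutions_swap D x h q : q \in involutions (D :\ x :\ h) ->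
  (tperm x h * q)%g x = h /\ (tperm x h * q)%g h = x.
Proof.
move=> qI; rewrite !permM tpermL tpermR.
by split; apply: (involutions_fix qI); rewrite !inE eqxx ?andbF.
Qed.

Lemma card_setD2 D x h : x \in D -> h \in D -> x != h -> #|D| = #|D :\ x :\ h|.+2.
Proof.
by move=> xD hD xh; rewrite (cardsD1 x) xD (cardsD1 h) !inE eq_sym xh hD.
Qed.

(** After multiplication by the transposition [x] and [h] share a cycle, so erasing their edge
    disconnects nothing. One vertex and one edge disappear and the faces are unchanged, hence so is
    the genus. *)
Lemma card_maps_merge A s D g x h :
  x \in D -> h \in D -> x \notin porbit s h ->
  #|[set e in maps A s D g | e x == h]| = #|maps A (tperm x h * s) (D :\ x :\ h) g|.
Proof.
move=> xD hD xh; have nxh : x != h by apply: contraNneq xh => ->; rewrite porbit_id.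
pose P e := conn A s e && euler A s D g e.
have -> : [set e in maps A s D g | e x == h] = [set e in involutions D | (e x == h) && P e].
  by apply/setP => e; rewrite !in_set -!andbA; do !bool_congr.
rewrite card_peel //; apply: eq_card => q; rewrite in_set in_maps.
case: (boolP (q \in involutions _)) => //= qI.
have [ex eh] := involutions_swap qI; set e := (tperm x h * q)%g in ex eh *.
have qE : q = (tperm x h * e)%g by rewrite /e mulgA tperm2 mul1g.
have cE := connect_tperm_l s ex eh; rewrite -qE in cE.
set p := (_ * s)%g in cE *.
have hx : connect (gen_rel p q) h x.
  have := porbit_tperm_merge xh; rewrite mem_porbit_fconnect.
  by apply: fconnect_gen_rel; exact: gen_rel_l.
have pqS := gen_rel_sym p q.
have cE' a b : connect (gen_rel s e) a b = connect (gen_rel p q) a b.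
  rewrite cE /add_edge /=; apply/or3P/idP => [[//|/andP[ax hb]|/andP[ah xb]]|]; last by constructor 1.
    by apply: connect_trans ax (connect_trans _ hb); rewrite pqS.
  by apply: connect_trans ah (connect_trans hx xb).
congr (_ && _).
  by apply/connP/connP => H a b aA bA; [rewrite -cE'|rewrite cE']; apply: H.
rewrite /euler qE mul_peel // (card_setD2 xD hD nxh).
have := porbits_mul_tperm s x h; rewrite /= xh nxh -/p -/(cyc _) -/(cyc _) => H.
by apply/eqP/eqP; lia.
Qed.

(* Two components, represented by [z] and [h]; [g] is the sum of their genera. *)
Definition bimaps A p D (z h : T) g :=
  [set q in involutions D |
    [&& ~~ connect (gen_rel p q) z h,
        [forall y in A, connect (gen_rel p q) z y || connect (gen_rel p q) h y] &
        cyc p + cyc (q * p) + g.*2 == (#|~: A|.+2).*2 + #|D|./2]].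

Lemma in_bimaps A p D z h g q : (q \in bimaps A p D z h g) =
  [&& q \in involutions D, ~~ connect (gen_rel p q) z h,
        [forall y in A, connect (gen_rel p q) z y || connect (gen_rel p q) h y] &
        cyc p + cyc (q * p) + g.*2 == (#|~: A|.+2).*2 + #|D|./2].
Proof. by rewrite inE. Qed.

(** Here the transposition cuts a vertex in two. Without the edge, the two halves are either still
    connected, with one handle fewer, or in two components whose genera add up to [g]. *)
Lemma card_maps_split A s D g x h :
  D \subset A -> perm_on A s ->
  x \in D -> h \in D -> x != h -> x \in porbit s h ->
  #|[set e in maps A s D g | e x == h]| =
    (if g is g'.+1 then #|maps A (tperm x h * s) (D :\ x :\ h) g'| else 0)
    + #|bimaps A (tperm x h * s) (D :\ x :\ h) x h g|.
Proof.
move=> DA sA xD hD nxh xh.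
pose P e := conn A s e && euler A s D g e.
have -> : [set e in maps A s D g | e x == h] = [set e in involutions D | (e x == h) && P e].
  by apply/setP => e; rewrite !in_set -!andbA; do !bool_congr.
have [xA hA] : x \in A /\ h \in A by split; apply: (subsetP DA).
rewrite card_peel //; set p := (_ * s)%g; set D' := D :\ x :\ h.
have D'A : D' \subset A by apply: subset_trans DA; apply/subsetP => y; rewrite !inE => /and3P[].
have pA : perm_on A p.
  apply: perm_onM => //; apply/subsetP => y; rewrite inE; by case: tpermP => [->|->|_ _]; rewrite ?eqxx.
set S := [set q in _ | _].
have inS q : (q \in S) = (q \in involutions D') && P (tperm x h * q)%g by rewrite [LHS]in_set.
rewrite -(cardsID [set q | connect (gen_rel p q) x h] S).
have cycp : cyc p = (cyc s).+1.
  by have := porbits_mul_tperm s x h; rewrite /= xh nxh -/p -/(cyc _) -/(cyc _); clear; lia.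
have cD := card_setD2 xD hD nxh; rewrite -/D' in cD.
(* The conditions on the map with the edge, restated without it: connected means that every point is
   reached from [x] or from [h]. *)
have key q : q \in involutions D' ->
  P (tperm x h * q)%g = [forall y in A, connect (gen_rel p q) x y || connect (gen_rel p q) h y]
     && (cyc p + cyc (q * p) + g.*2 == (#|~: A|.+2).*2 + #|D'|./2).
  move=> qI; have [ex eh] := involutions_swap qI; set e := (tperm x h * q)%g in ex eh *.
  have qE : q = (tperm x h * e)%g by rewrite /e mulgA tperm2 mul1g.
  have cE := connect_tperm_l s ex eh; rewrite -qE -/p in cE.
  rewrite /P; congr (_ && _).
    have xE y : connect (gen_rel s e) x y = connect (gen_rel p q) x y || connect (gen_rel p q) h y.
      rewrite cE /add_edge /= connect0 /=.
      by case: (connect (gen_rel p q) x y); rewrite ?orbT ?andbF ?orbF.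
    apply/connP/forall_inP => [H y yA|H]; first by rewrite -xE H.
    by apply/connP; apply: (conn_base xA) => y yA; rewrite xE H.
  rewrite /euler qE mul_peel // cD cycp.
  by apply/eqP/eqP; clear; lia.
congr (_ + _).
- have S1 q : (q \in S :&: [set q | connect (gen_rel p q) x h]) =
   [&& q \in involutions D', conn A p q &
     cyc p + cyc (q * p) + g.*2 == (#|~: A|.+2).*2 + #|D'|./2].
    rewrite in_setI inS [X in _ && X]in_set -andbA; case: (boolP (q \in involutions D')) => // qI.
    rewrite !andTb key // andbAC; congr (_ && _).
    apply/andP/connP => [[/forall_inP H xhc]|H].
      apply/connP/(conn_base xA) => y /H /orP[//|]; exact: connect_trans.
    by split; [apply/forall_inP => y yA; rewrite H|apply: H].
  (* For [g = 0] a connected split map would have genus -1, which [conn_genus] excludes. *)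
  case: g @P key @S inS S1 => [|g] P key S inS S1.
    apply: eq_card0 => q; rewrite S1; apply/and3P => -[qI cA /eqP E].
    have [k [m [Dm E']]] := conn_genus xA pA D'A qI cA.
    by rewrite Dm doubleK in E; clear -E E'; lia.
  apply: eq_card => q; rewrite S1 in_maps /euler; do 2!congr (_ && _).
  by apply/eqP/eqP; clear; lia.
- apply: eq_card => q; rewrite in_setD inS [q \in [set _ | _]]in_set in_bimaps.
  case: (boolP (q \in involutions D')) => qI; last by rewrite andbF.
  by rewrite key.
Qed.

(** As for [maps_del]; the deleted [x] represented its component, and [z], on the same cycle, takes
    over. *)
Lemma bimaps_del A p D g x z h :
  x \in A -> perm_on A p -> x \notin D -> p x != x -> x != h -> z != x -> z \in porbit p x ->
  bimaps A p D x h g = bimaps (A :\ x) (del x p) D z h g.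
Proof.
move=> xA pA xD px xh zx zpx; apply/setP => q; rewrite !in_bimaps.
case: (boolP (q \in involutions D)) => //= qI.
have qx := involutions_fix qI xD.
have qpx : (q * p)%g x != x by rewrite permM qx.
have xz : connect (gen_rel p q) x z.
  by move: zpx; rewrite mem_porbit_fconnect; apply: fconnect_gen_rel; exact: gen_rel_l.
have xzE y : connect (gen_rel p q) x y = connect (gen_rel p q) z y := same_connect (gen_rel_sym p q) xz y.
rewrite xzE connect_del // 1?eq_sym //; congr [&& _, _ & _].
  apply/forall_inP/forall_inP => H y.
    by rewrite !inE => /andP[yx yA]; rewrite !connect_del // 1?eq_sym // -xzE H.
  move=> yA; have [->|yx] := eqVneq y x; first by rewrite connect0.
  by have := H y; rewrite !inE yx yA !connect_del // 1?eq_sym // -xzE; apply.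
by rewrite mul_del // !cyc_del // card_setCD1 //; apply/eqP/eqP; lia.
Qed.

End Maps.

(** * Permutations with disjoint supports, and maps with two components *)

Section DisjointSupports.
Variable T : finType.
Implicit Types (s e p q t u v : {perm T}) (A B D : {set T}).

Lemma porbit_stable u A x y :
  (forall z, (u z \in A) = (z \in A)) -> y \in porbit u x -> (y \in A) = (x \in A).
Proof.
move=> uA /porbitP[i ->]; elim: i => [|i IH]; first by rewrite expg0 perm1.
by rewrite expgSr permM uA IH.
Qed.

Lemma eq_porbit_on u v A x :
  (forall z, (u z \in A) = (z \in A)) -> {in A, u =1 v} -> x \in A ->
  porbit u x = porbit v x.
Proof.
move=> uA uv xA.
have E i : (u ^+ i)%g x = (v ^+ i)%g x /\ (u ^+ i)%g x \in A.
  elim: i => [|i [IH iA]]; first by rewrite !expg0 perm1.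
  by rewrite !expgSr !permM uA -IH uv.
by apply/setP => y; apply/porbitP/porbitP => -[i ->]; exists i; case: (E i).
Qed.

Lemma card_porbits_setU u A B :
  (forall z, (u z \in A) = (z \in A)) -> [disjoint A & B] ->
  #|porbit u @: (A :|: B)| = #|porbit u @: A| + #|porbit u @: B|.
Proof.
move=> uA dAB; rewrite imsetU cardsU disjoint_setI0 ?cards0 ?subn0 //.
rewrite -setI_eq0; apply/eqP/setP => X; rewrite !inE; apply/andP => -[/imsetP[x xA ->] /imsetP[y yB E]].
have : y \in porbit u x by rewrite E porbit_id.
move/(porbit_stable uA); rewrite xA => yA.
by move/pred0P: dAB => /(_ y); rewrite /= yA yB.
Qed.

Lemma cyc_on A u : perm_on A u -> cyc u = #|porbit u @: A| + #|~: A|.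
Proof.
move=> uA; have uA' z : (u z \in A) = (z \in A) by exact: perm_closed.
have -> : cyc u = #|porbit u @: (A :|: ~: A)|.
  by rewrite setUCr; apply: eq_card => X; apply/imsetP/imsetP => -[x _ ->]; exists x; rewrite ?inE.
rewrite card_porbits_setU // -?setI_eq0 ?setICr //; congr (_ + _).
apply: card_in_imset => x y; rewrite !inE => xA yA /eqP.
rewrite eq_porbit_mem => /porbitP[i ->].
by elim: i => [|i IH]; rewrite ?expg0 ?perm1 // expgSr permM IH (out_perm uA).
Qed.

Section Pair.
Variables (A1 A2 : {set T}).
Hypothesis dA : [disjoint A1 & A2].

Lemma notin_right x : x \in A1 -> x \notin A2.
Proof. by move=> x1; rewrite (disjointFr dA). Qed.

Lemma notin_left x : x \in A2 -> x \notin A1.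
Proof. by move=> x1; rewrite (disjointFl dA). Qed.

Lemma mul_disjointE u v x : perm_on A1 u -> perm_on A2 v ->
  (u * v)%g x = if x \in A1 then u x else v x.
Proof.
move=> uA vA; rewrite permM; case: ifP => x1.
  by rewrite (out_perm vA) // notin_right // perm_closed.
by rewrite (out_perm uA) // x1.
Qed.

(** [cyc u] counts the points outside [A1] as fixed and [cyc v] those outside [A2]; as [A1] and [A2]
    are disjoint, the excess over the points outside both is [#|T|]. *)
Lemma cyc_mul_disjoint u v : perm_on A1 u -> perm_on A2 v ->
  cyc (u * v) + #|T| = cyc u + cyc v.
Proof.
move=> uA vA.
have uvA : perm_on (A1 :|: A2) (u * v)%g.
  by apply: perm_onM; [apply: subset_trans uA _|apply: subset_trans vA _]; rewrite ?subsetUl ?subsetUr.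
have uA' z : (u z \in A1) = (z \in A1) by exact: perm_closed.
have vA' z : (v z \in A2) = (z \in A2) by exact: perm_closed.
have uvA' z : ((u * v)%g z \in A1) = (z \in A1).
  rewrite mul_disjointE //; case: ifP => z1; rewrite ?uA' ?z1 //.
  case: (boolP (z \in A2)) => z2; last by rewrite (out_perm vA) ?z1.
  by apply/negbTE/notin_left; rewrite vA'.
rewrite (cyc_on uvA) card_porbits_setU // (cyc_on uA) (cyc_on vA).
have -> : porbit (u * v) @: A1 = porbit u @: A1.
  apply: eq_in_imset => x x1; apply: (@eq_porbit_on _ _ A1) => // y y1.
  by rewrite mul_disjointE // y1.
have -> : porbit (u * v) @: A2 = porbit v @: A2.
  apply: eq_in_imset => x x2; symmetry; apply: (@eq_porbit_on _ _ A2) => // y y2.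
  by rewrite mul_disjointE // (negPf (notin_left y2)).
have := cardsC A1; have := cardsC A2; have := cardsC (A1 :|: A2).
by rewrite cardsU (disjoint_setI0 dA) cards0; lia.
Qed.

Lemma mul_disjoint_interchange u u' v v' :
  perm_on A1 u -> perm_on A1 u' -> perm_on A2 v -> perm_on A2 v' ->
  (u * v * (u' * v') = (u * u') * (v * v'))%g.
Proof.
move=> uA uA' vA vA'.
have C : (v * u' = u' * v)%g.
  apply/permP => x; rewrite [RHS]mul_disjointE // permM; case: ifP => x1.
    by rewrite (out_perm vA) // notin_right.
  case: (boolP (x \in A2)) => x2.
    by rewrite (out_perm uA') // notin_left // perm_closed.
  by rewrite (out_perm vA) // (out_perm uA') // x1.
by rewrite !mulgA -(mulgA u v) C !mulgA.
Qed.

Variables (p1 p2 : {perm T}).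
Hypotheses (p1A : perm_on A1 p1) (p2A : perm_on A2 p2).

Lemma connect_mul_l q1 q2 a b : perm_on A1 q1 -> perm_on A2 q2 -> a \in A1 ->
  connect (gen_rel (p1 * p2) (q1 * q2)) a b = connect (gen_rel p1 q1) a b.
Proof.
move=> q1A q2A; apply: eq_connect_on => x y x1; rewrite /gen_rel /= !mul_disjointE // x1 //.
by case/orP=> /eqP->; rewrite perm_closed.
Qed.

Lemma connect_mul_r q1 q2 a b : perm_on A1 q1 -> perm_on A2 q2 -> a \in A2 ->
  connect (gen_rel (p1 * p2) (q1 * q2)) a b = connect (gen_rel p2 q2) a b.
Proof.
move=> q1A q2A; apply: eq_connect_on => x y x2;
  rewrite /gen_rel /= !mul_disjointE // (negPf (notin_left x2)) //.
by case/orP=> /eqP->; rewrite perm_closed.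
Qed.

Variables (D1 D2 : {set T}).
Hypotheses (D1A : D1 \subset A1) (D2A : D2 \subset A2).

Lemma mul_involutions q1 q2 : q1 \in involutions D1 -> q2 \in involutions D2 ->
  (q1 * q2)%g \in involutions (D1 :|: D2).
Proof.
move=> I1 I2; have q1A := involutions_on I1 D1A; have q2A := involutions_on I2 D2A.
case/involutionsP: I1 => qq1 qD1; case/involutionsP: I2 => qq2 qD2.
apply/involutionsP; split=> x; rewrite ?inE !mul_disjointE //; case: (boolP (x \in A1)) => x1.
- by rewrite perm_closed // x1 qq1.
- rewrite ifN ?qq2 //; case: (boolP (x \in A2)) => x2; last by rewrite (out_perm q2A).
  by apply: notin_left; rewrite perm_closed.
- rewrite qD1 (negPf (_ : x \notin D2)) ?orbF //.
  by apply: contra (notin_right x1); exact: (subsetP D2A).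
- by rewrite qD2; case: (boolP (x \in D1)) => // /(subsetP D1A); rewrite (negPf x1).
Qed.

Lemma involutions_split q : q \in involutions (D1 :|: D2) ->
  (forall x, (q x \in A1) = (x \in A1)) ->
  exists q1 q2, [/\ q1 \in involutions D1, q2 \in involutions D2 & q = (q1 * q2)%g].
Proof.
move=> qI qA; case/involutionsP: (qI) => qq qD.
have nA (B : {set T}) : (forall x, (q x \in B) = (x \in B)) -> q \in 'N(B | 'P).
  by move=> qB; apply/astabsP => x; exact: qB.
(* [q] preserves [A1] and therefore its complement; the second factor is taken on the whole
   complement, where it moves exactly the points of [D2]. *)
pose q1 := restr_perm A1 q; pose q2 := restr_perm (~: A1) q.
have qC x : (q x \in ~: A1) = (x \in ~: A1) by rewrite !inE qA.
have q1E x : q1 x = if x \in A1 then q x else x.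
  case: ifP => x1; first by rewrite /q1 restr_permE // nA.
  by rewrite (out_perm (restr_perm_on _ _)) ?x1.
have q2E x : q2 x = if x \in A1 then x else q x.
  case: ifP => x1; first by rewrite (out_perm (restr_perm_on _ _)) // inE x1.
  by rewrite /q2 restr_permE ?nA // inE x1.
exists q1, q2; split.
- apply/involutionsP; split=> x; rewrite !q1E; case: (boolP (x \in A1)) => x1.
  + by rewrite qA x1.
  + by rewrite (negPf x1).
  + rewrite qD inE; case: (boolP (x \in D2)) => [x2|]; rewrite ?orbF //.
    by have := notin_right x1; rewrite (subsetP D2A).
  + by rewrite eqxx; symmetry; apply: contraNF x1; exact: (subsetP D1A).
- apply/involutionsP; split=> x; rewrite !q2E; case: (boolP (x \in A1)) => x1.
  + by rewrite x1.
  + by rewrite qA (negPf x1).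
  + by rewrite eqxx; symmetry; apply: contraTF x1 => x2; apply: notin_left; exact: (subsetP D2A).
  + by rewrite qD inE; case: (boolP (x \in D1)) => // /(subsetP D1A); rewrite (negPf x1).
- by apply/permP => x; rewrite permM q1E q2E; case: (boolP (x \in A1)) => x1; rewrite ?qA ?x1 ?(negPf x1).
Qed.

(** The added condition says that the component of [h] is [A1], so [q] factors uniquely into a
    connected map on each side, and the two genera add up to [g]. *)
Lemma card_bimaps_product z h g : h \in A1 -> z \in A2 ->
  #|[set q in bimaps (A1 :|: A2) (p1 * p2) (D1 :|: D2) z h g
      | [forall y in A1 :|: A2, connect (gen_rel (p1 * p2) q) h y == (y \in A1)]]|
  = \sum_(g1 < g.+1) #|maps A1 p1 D1 g1| * #|maps A2 p2 D2 (g - g1)|.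
Proof.
move=> hA zA.
pose tot q := cyc (p1 * p2) + cyc (q * (p1 * p2)) + g.*2
               == (#|~: (A1 :|: A2)|.+2).*2 + #|D1 :|: D2|./2.
pose PP := [set w : {perm T} * {perm T} | [&& w.1 \in involutions D1, w.2 \in involutions D2,
   conn A1 p1 w.1, conn A2 p2 w.2 & tot (w.1 * w.2)%g]].
have inPP w : (w \in PP) = [&& w.1 \in involutions D1, w.2 \in involutions D2,
   conn A1 p1 w.1, conn A2 p2 w.2 & tot (w.1 * w.2)%g] by rewrite [LHS]in_set.
set S := [set q in _ | _].
have inS q : (q \in S) = [&& q \in involutions (D1 :|: D2), ~~ connect (gen_rel (p1 * p2) q) z h,
   [forall y in A1 :|: A2, connect (gen_rel (p1 * p2) q) z y || connect (gen_rel (p1 * p2) q) h y],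
   tot q & [forall y in A1 :|: A2, connect (gen_rel (p1 * p2) q) h y == (y \in A1)]].
  by rewrite [LHS]in_set in_bimaps -!andbA.
have -> : S = (fun w => w.1 * w.2)%g @: PP.
  apply/setP => q; apply/idP/imsetP.
  - rewrite inS => /and5P[qI zh /forall_inP qzh tq /forall_inP qA1].
    have qh y : y \in A1 :|: A2 -> connect (gen_rel (p1 * p2) q) h y = (y \in A1).
      by move=> /qA1/eqP.
    have qst x : (q x \in A1) = (x \in A1).
      case: (boolP (x \in A1 :|: A2)) => x12.
        have qx12 : q x \in A1 :|: A2.
          rewrite perm_closed //; apply: (involutions_on qI).
          by apply: setUSS.
        rewrite -!qh //; apply/idP/idP => H; apply: connect_trans H _; last exact: gen_rel_r.
        by rewrite gen_rel_sym gen_rel_r.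
      rewrite (involutions_fix qI) //; apply: contra x12; apply: subsetP; exact: setUSS.
    have [q1 [q2 [I1 I2 qE]]] := involutions_split qI qst.
    have q1A := involutions_on I1 D1A; have q2A := involutions_on I2 D2A.
    exists (q1, q2) => //; rewrite inPP /= I1 I2 -qE tq andbT /=; apply/andP; split.
      apply: (conn_base hA) => y y1.
      by rewrite -(connect_mul_l (q2 := q2)) // -qE qh // inE y1.
    apply: (conn_base zA) => y y2; rewrite -(connect_mul_r (q1 := q1)) // -qE.
    have y12 : y \in A1 :|: A2 by rewrite inE y2 orbT.
    have := qzh y y12; rewrite qh // (negPf (notin_left y2)) orbF //.
  - case=> -[q1 q2]; rewrite inPP /= => /and5P[I1 I2 c1 c2 tq] qE.
    have q1A := involutions_on I1 D1A; have q2A := involutions_on I2 D2A.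
    move/connP: c1 => c1; move/connP: c2 => c2.
    have hE y : y \in A1 :|: A2 -> connect (gen_rel (p1 * p2) q) h y = (y \in A1).
      rewrite inE qE; case: (boolP (y \in A1)) => /= y1.
        by move=> _; rewrite connect_mul_l // c1.
      move=> y2; rewrite gen_rel_sym connect_mul_r //; apply/negbTE.
      apply: contra (notin_right hA).
      move=> H; apply: (connect_ind_closed (P := fun x => x \in A2) _ H y2) => u v uA.
      by case/orP=> /eqP->; rewrite perm_closed.
    rewrite inS qE tq mul_involutions //= -qE; apply/and3P; split.
    + by rewrite gen_rel_sym hE ?notin_left // inE zA orbT.
    + apply/forall_inP => y y12; rewrite hE //; move: y12; rewrite inE orbC.
      case: (y \in A1); rewrite ?orbT //= !orbF => y2.
      by rewrite qE connect_mul_r // c2.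
    + by apply/forall_inP => y y12; rewrite hE.
rewrite card_in_imset; last first.
  move=> [q1 q2] [q1' q2']; rewrite !inPP /= => /and5P[I1 I2 _ _ _] /and5P[J1 J2 _ _ _] /permP E.
  have q1A := involutions_on I1 D1A; have q2A := involutions_on I2 D2A.
  have q1A' := involutions_on J1 D1A; have q2A' := involutions_on J2 D2A.
  congr (_, _); apply/permP => x; have := E x; rewrite !mul_disjointE //; case: ifP => x1 // _.
    by rewrite !(out_perm _ (negbT x1)).
  by rewrite !(out_perm _ (notin_right x1)).
pose X (g1 : 'I_g.+1) := setX (maps A1 p1 D1 g1) (maps A2 p2 D2 (g - g1)).
(* Both sides become sums over pairs. A pair of connected maps has definite genera [k1] and [k2], so
   it is counted only at [g1 = k1], and only if [k1 + k2 = g]. *)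
transitivity (\sum_(w : {perm T} * {perm T}) \sum_(g1 < g.+1) (w \in X g1 : nat)); last first.
  rewrite exchange_big /=; apply: eq_bigr => g1 _; rewrite -cardsX -sum1_card [RHS]big_mkcond /=.
  by apply: eq_bigr => w _; rewrite /X; case: (_ \in _).
rewrite -sum1_card big_mkcond; apply: eq_bigr => -[q1 q2] _ /=.
rewrite inPP /=.
have inX g1 : (q1, q2) \in X g1 = [&& q1 \in involutions D1, q2 \in involutions D2,
   conn A1 p1 q1, conn A2 p2 q2 & euler A1 p1 D1 g1 q1 && euler A2 p2 D2 (g - g1) q2].
  rewrite in_setX /= !in_maps.
  by case: (q1 \in _); case: (q2 \in _); case: (conn _ _ _); case: (conn _ _ _); rewrite /= ?andbF.
case: (boolP (q1 \in involutions D1)) inX => I1 inX; last by rewrite big1 // => i _; rewrite inX.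
case: (boolP (q2 \in involutions D2)) inX => I2 inX; last by rewrite big1 // => i _; rewrite inX.
case: (boolP (conn A1 p1 q1)) inX => c1 inX; last by rewrite big1 // => i _; rewrite inX.
case: (boolP (conn A2 p2 q2)) inX => c2 inX; last by rewrite big1 // => i _; rewrite inX.
rewrite /= in inX *.
have q1A := involutions_on I1 D1A; have q2A := involutions_on I2 D2A.
have [k1 [m1 [Dm1 E1]]] := conn_genus hA p1A D1A I1 c1.
have [k2 [m2 [Dm2 E2]]] := conn_genus zA p2A D2A I2 c2.
have dD : #|D1 :|: D2| = (m1 + m2).*2.
  rewrite cardsU Dm1 Dm2 disjoint_setI0 ?cards0 ?subn0 ?doubleD //.
  by apply: disjointWl D1A _; apply: disjointWr D2A _.
have totE : tot (q1 * q2)%g = (k1 + k2 == g).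
  rewrite /tot mul_disjoint_interchange // dD doubleK.
  have H1 := cyc_mul_disjoint p1A p2A.
  have H2 := cyc_mul_disjoint (perm_onM q1A p1A) (perm_onM q2A p2A).
  have H3 := cardsC A1; have H4 := cardsC A2; have := cardsC (A1 :|: A2).
  rewrite cardsU (disjoint_setI0 dA) cards0 => H5.
  by apply/eqP/eqP; clear -E1 E2 H1 H2 H3 H4 H5; lia.
rewrite totE.
have XE (g1 : 'I_g.+1) : (q1, q2) \in X g1 = (k1 + k2 == g) && (g1 == k1 :> nat).
  rewrite inX /euler Dm1 Dm2 !doubleK; have := ltn_ord g1 => g1g.
  by apply/andP/andP => -[/eqP e1 /eqP e2]; split; apply/eqP; clear -E1 E2 g1g e1 e2; lia.
case: eqP => kg; last first.
  by rewrite big1 // => i _; rewrite XE; case: eqP.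
have k1g : k1 < g.+1 by clear -kg; lia.
rewrite (bigD1 (Ordinal k1g)) //= XE eqxx kg eqxx big1 ?addn0 // => i ik.
by rewrite XE; case: (i =P k1 :> nat) => [E|]; rewrite ?andbF //; case/eqP: ik; apply: val_inj.
Qed.

End Pair.
End DisjointSupports.

(** * Rotations presented by the list of their cycles *)

Section RotationSystems.
Variable T : finType.
Implicit Types (s p : {perm T}) (a b l : seq T) (L : seq (seq T)).

Lemma eq_in_fpath s s' c a z : {in c :: a, s =1 s'} ->
  fpath s c (rcons a z) = fpath s' c (rcons a z).
Proof.
elim: a c => [|d a IH] c H /=; first by rewrite H ?inE.
rewrite H ?inE ?eqxx // IH // => y ya; apply: H; by rewrite inE ya orbT.
Qed.

Lemma eq_in_fcycle s s' l : {in l, s =1 s'} -> fcycle s l = fcycle s' l.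
Proof. case: l => [//|x l]; exact: eq_in_fpath. Qed.

(** The transposition acts first and moves only [x] and [y], so [x] takes over the path that left
    [y]; the later points are unaffected. *)
Lemma fpath_tperm s x y b z : x \notin b -> y \notin b ->
  fpath s y (rcons b z) -> fpath (tperm x y * s)%g x (rcons b z).
Proof.
case: b => [|c b] xb yb /=; rewrite permM tpermL //.
case/andP=> -> H /=; rewrite -(eq_in_fpath (s := s)) // => w wb.
by rewrite permM tpermD //; apply: contraTneq wb => <-.
Qed.

Lemma fpath_del s x c a : x \notin c :: a ->
  fpath s c (rcons a x) -> fpath (del x s) c (rcons a (s x)).
Proof.
elim: a c => [|d a IH] c xc /=.
  rewrite !andbT delE => ->; rewrite ifN ?eqxx //.
  by apply: contra xc => /eqP->; rewrite inE.
case/andP=> /eqP sc H; move: xc; rewrite inE negb_or => /andP[xc xd].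
rewrite IH // andbT delE ifN 1?eq_sym // sc ifN ?eqxx //.
by apply: contra xd => /eqP->; rewrite inE eqxx.
Qed.

(** All points outside the lists are fixed, so [L] determines [s]. Empty lists are permitted here
    and excluded where cycles are counted. *)
Definition rotsys s L :=
  [/\ uniq (flatten L), all (fcycle s) L & forall x, x \notin flatten L -> s x = x].

Definition supp L : {set T} := [set x in flatten L].

(** The head of each list is the marker of that vertex. *)
Definition darts L : {set T} := [set x in flatten (map behead L)].

Lemma rotsys_on s L : rotsys s L -> perm_on (supp L) s.
Proof.
case=> _ _ H; apply/subsetP => x; rewrite inE; apply: contraR; rewrite inE => /H->//.
Qed.

Lemma supp_perm L L' : perm_eq L L' -> supp L = supp L'.
Proof. by move=> LL; apply/setP => x; rewrite !inE (perm_mem (perm_flatten LL)). Qed.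

Lemma darts_perm L L' : perm_eq L L' -> darts L = darts L'.
Proof.
by move=> LL; apply/setP => x; rewrite !inE (perm_mem (perm_flatten (perm_map _ LL))).
Qed.

Lemma sub_darts L : darts L \subset supp L.
Proof.
apply/subsetP => x; rewrite !inE => /flattenP[l' /mapP[l lL ->] xl].
by apply/flattenP; exists l => //; exact: mem_behead.
Qed.

Lemma rotsys_perm s L L' : perm_eq L L' -> rotsys s L -> rotsys s L'.
Proof.
move=> LL; have FL := perm_flatten LL.
case=> U C F; split; first by rewrite -(perm_uniq FL).
  by rewrite -(perm_all _ LL).
by move=> x; rewrite -(perm_mem FL); exact: F.
Qed.

(** A cycle can be read from any of its points; only [darts] depends on which one is the head. *)
Lemma rotsys_catC s a b L : rotsys s ((a ++ b) :: L) -> rotsys s ((b ++ a) :: L).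
Proof.
case=> /= U /andP[C CL] F; split => /=.
- by rewrite -(perm_uniq (s1 := (a ++ b) ++ flatten L)) // perm_cat2r perm_catC.
- by rewrite cycle_catC C.
- by move=> x xL; apply: F; apply: contra xL; rewrite !mem_cat [(x \in b) || _]orbC.
Qed.

Lemma rotsys_other_tperm s x y a L :
  x \in a -> y \in a -> uniq (a ++ flatten L) -> all (fcycle s) L ->
  all (fcycle (tperm x y * s)%g) L.
Proof.
move=> xa ya; rewrite cat_uniq => /and3P[_ /hasPn H _] /allP C; apply/allP => l lL.
rewrite -(eq_in_fcycle (s := s)) ?C // => z zl.
have za : z \notin a by apply: H; apply/flattenP; exists l.
by rewrite permM tpermD //; apply: contraNneq za => <-.
Qed.

Lemma uniq_cons_cat_cons x y a b (c : seq T) : uniq ((x :: a ++ y :: b) ++ c) ->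
  [/\ x \notin a, x \notin b, y \notin a & y \notin b].
Proof.
rewrite cat_uniq /= mem_cat inE !negb_or cat_uniq /= !negb_or -!andbA.
by case/and5P=> xa _ xb _ /and4P[ya _ yb _].
Qed.

(** Under [tperm x y * s] the point [x] continues with what followed [y], and [y] with what followed
    [x]; this splices the two cycles. *)
Lemma rotsys_merge s x y a b L : rotsys s ((x :: a) :: (y :: b) :: L) ->
  rotsys (tperm x y * s)%g ((x :: b ++ y :: a) :: L).
Proof.
case=> U C F; have P : perm_eq (flatten ((x :: a) :: (y :: b) :: L)) (flatten ((x :: b ++ y :: a) :: L)).
  by apply/seq.permP => Q; rewrite /= !(count_cat, cat_cons) /= !count_cat /=; clear; lia.
have U' := U; rewrite (perm_uniq P) in U'.
split=> //.
- move: C; rewrite /= => /and3P[Cx Cy CL].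
  have [xb xa yb ya] := uniq_cons_cat_cons U'.
  rewrite rcons_cat cat_path /=.
  have H := fpath_tperm xb yb Cy; rewrite rcons_path /= in H.
  case/andP: H => -> -> /=.
  have := fpath_tperm ya xa Cx; rewrite tpermC => -> /=.
  apply: (rotsys_other_tperm (a := x :: b ++ y :: a)) => //; by rewrite !inE ?mem_cat ?inE ?eqxx ?orbT.
- move=> z; rewrite -(perm_mem P) => zF; rewrite permM tpermD ?F //.
    by apply: contraNneq zF => <-; rewrite /= inE eqxx.
  by apply: contraNneq zF => <-; rewrite /= inE mem_cat inE eqxx !orbT.
Qed.

(** The same exchange of successors inside one cycle closes it up into two. *)
Lemma rotsys_split s x y a b L : rotsys s ((x :: a ++ y :: b) :: L) ->
  rotsys (tperm x y * s)%g ((x :: b) :: (y :: a) :: L).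
Proof.
case=> U C F; have P : perm_eq (flatten ((x :: b) :: (y :: a) :: L)) (flatten ((x :: a ++ y :: b) :: L)).
  by apply/seq.permP => Q; rewrite /= !(count_cat, cat_cons) /= !count_cat /=; clear; lia.
have U' := U; rewrite -(perm_uniq P) in U'.
split=> //.
- move: C; rewrite /= => /andP[Cx CL].
  have [xa xb ya yb] := uniq_cons_cat_cons U.
  move: Cx; rewrite rcons_cat cat_path /= => /and3P[Ca /eqP La Cb].
  have -> /= := fpath_tperm xb yb Cb.
  have Ca' : fpath s x (rcons a y) by rewrite rcons_path Ca /= La.
  have := fpath_tperm ya xa Ca'; rewrite tpermC => -> /=.
  apply: (rotsys_other_tperm (a := x :: a ++ y :: b)) => //; by rewrite !inE ?mem_cat ?inE ?eqxx ?orbT.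
- move=> z; rewrite (perm_mem P) => zF; rewrite permM tpermD ?F //.
    by apply: contraNneq zF => <-; rewrite /= inE eqxx.
  by apply: contraNneq zF => <-; rewrite /= inE !mem_cat inE eqxx !orbT.
Qed.

Lemma rotsys_head_move s x a L : rotsys s ((x :: a) :: L) -> a != [::] -> s x != x.
Proof.
case=> /= /andP[xa _] /andP[C _] _; case: a xa C => //= c a xa /andP[/eqP-> _] _.
by apply: contraNneq xa => ->; rewrite inE eqxx.
Qed.

Lemma rotsys_del s x a L : rotsys s ((x :: a) :: L) -> a != [::] ->
  rotsys (del x s) (a :: L).
Proof.
case=> U C F a0; split; first by case/andP: U.
- case: a a0 U C F => //= c a _ /andP[xU U] /andP[/andP[/eqP sx C] CL] F.
  have xca : x \notin c :: a by apply: contra xU; rewrite !inE mem_cat => /orP[->|->] //; rewrite orbT.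
  apply/andP; split; first by have := fpath_del xca C; rewrite sx.
  apply/allP => l lL; rewrite -(eq_in_fcycle (s := s)) ?(allP CL) // => z zl.
  have xl w : w \in l -> (w == x) = false.
    move=> wl; apply: contraNF xU => /eqP <-; rewrite inE mem_cat.
    by apply/orP; right; apply/orP; right; apply/flattenP; exists l.
  by rewrite delE !xl // (mem_fcycle (allP CL l lL)).
- move=> z za; rewrite delE; have [->//|zx] := eqVneq z x.
  have -> : s z = z by apply: F; rewrite /= inE (negPf zx).
  by rewrite (negPf zx).
Qed.

Lemma rotsys_mul s1 s2 L1 L2 : uniq (flatten (L1 ++ L2)) ->
  rotsys s1 L1 -> rotsys s2 L2 -> rotsys (s1 * s2)%g (L1 ++ L2).
Proof.
rewrite flatten_cat cat_uniq => /and3P[U1 /hasPn D U2] [_ C1 F1] [_ C2 F2]; split.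
- by rewrite flatten_cat cat_uniq U1 U2 andbT; apply/hasPn.
- rewrite all_cat; apply/andP; split; apply/allP => l lL.
    rewrite -(eq_in_fcycle (s := s1)) ?(allP C1) // => z zl; rewrite permM F2 //.
    apply/negP => /D /negP; apply; apply/flattenP; exists l => //.
    exact: (mem_fcycle (allP C1 l lL)).
  rewrite -(eq_in_fcycle (s := s2)) ?(allP C2) // => z zl; rewrite permM F1 //.
  by apply: D; apply/flattenP; exists l.
- by move=> z; rewrite flatten_cat mem_cat negb_or => /andP[z1 z2]; rewrite permM F1 // F2.
Qed.

Lemma rotsys_inj s1 s2 L : rotsys s1 L -> rotsys s2 L -> s1 = s2.
Proof.
case=> _ C1 F1 [_ C2 F2]; apply/permP => x.
case: (boolP (x \in flatten L)) => [/flattenP[l lL xl]|xL]; last by rewrite F1 // F2.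
by rewrite -(nextE (allP C1 l lL) xl) -(nextE (allP C2 l lL) xl).
Qed.

Lemma rotsys_exists L : uniq (flatten L) -> exists s, rotsys s L.
Proof.
elim: L => [|l L IH] U.
  by exists 1%g; split=> // x _; rewrite perm1.
have [UL Ul] : uniq (flatten L) /\ uniq l by move: U; rewrite /= cat_uniq => /and3P[].
have [s sL] := IH UL.
pose c := perm (can_inj (prev_next Ul)).
exists (c * s)%g; apply: (@rotsys_mul _ _ [:: l]) => //; split=> /=; rewrite ?cats0 //.
  rewrite andbT -(eq_fcycle (f := next l)) ?cycle_next // => x; by rewrite permE.
by move=> x xl; rewrite permE next_nth (negPf xl).
Qed.

Lemma rotsys_porbit s L l x : rotsys s L -> l \in L -> x \in l ->
  porbit s x = [set y in l].
Proof.
case=> _ C _ lL xl; apply/setP => y.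
by rewrite mem_porbit_fconnect (fconnect_cycle (allP C l lL)) // inE.
Qed.

(** Nonempty disjoint lists are distinct cycles; each remaining point is a cycle by itself. *)
Lemma rotsys_cyc s L : rotsys s L -> [::] \notin L -> cyc s = size L + #|~: supp L|.
Proof.
move=> sL L0; rewrite (cyc_on (rotsys_on sL)); congr (_ + _).
case: sL => U /allP C _.
elim: L L0 U C => [|l L IH].
  by move=> *; apply/eqP; rewrite cards_eq0 -subset0; apply/subsetP => X /imsetP[x]; rewrite inE.
rewrite inE negb_or => /andP[l0 L0]; rewrite /= cat_uniq => /and3P[Ul /hasPn D UL] C.
have Cl : fcycle s l by apply: C; rewrite inE eqxx.
have -> : supp (l :: L) = [set x in l] :|: supp L by apply/setP => x; rewrite !inE mem_cat.
rewrite card_porbits_setU ?IH //.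
- rewrite -add1n; congr (_ + _); case: l l0 {D C Ul} Cl => // x l _ Cl.
  apply/eqP/cards1P; exists [set y in x :: l]; apply/setP => X; rewrite !inE.
  have E z : z \in x :: l -> porbit s z = [set y in x :: l].
    by move=> zl; apply/setP => y; rewrite mem_porbit_fconnect (fconnect_cycle Cl) // inE.
  apply/imsetP/eqP => [[z]|->]; first by rewrite in_set => /E-> ->.
  by exists x; rewrite ?E ?in_set ?mem_head.
- by move=> l' l'L; apply: C; rewrite inE l'L orbT.
- move=> z; rewrite !inE; apply/idP/idP => H; last by apply: (mem_fcycle Cl).
  have : fconnect s z (s z) by exact: fconnect1.
  by rewrite fconnect_sym ?(fconnect_cycle Cl) //; exact: perm_inj.
- by rewrite -setI_eq0; apply/eqP/setP => x; rewrite !inE; apply/andP => -[xl /D]; rewrite /= xl.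
Qed.

End RotationSystems.

(** * Comparison with the block encoding of [cellular_maps], and removal of the markers *)

Lemma rot_cons m mu h : Defs.rot (m :: mu) h =
  if h < m then (if h.+1 < m then h.+1 else 0) else m + Defs.rot mu (h - m).
Proof.
have offS i : offset (m :: mu) i.+1 = m + offset mu i by [].
have vE : vert_of (m :: mu) h = (m <= h) + count (fun i => m + offset mu i.+1 <= h) (iota 0 (size mu)).
  rewrite /vert_of /= /offset /= take0 /= addn0; congr (_ + _).
  by rewrite -(addn0 1) iotaDl count_map; apply: eq_count.
rewrite /Defs.rot; cbv zeta; case: (ltnP h m) => hm.
  have -> : vert_of (m :: mu) h = 0.
    rewrite vE leqNgt hm add0n; apply/eqP; rewrite -leqn0 leqNgt -has_count.
    by apply/hasPn => i _; rewrite -ltnNge ltn_addr.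
  by rewrite offS /offset take0 addn0.
have -> : vert_of (m :: mu) h = (vert_of mu (h - m)).+1.
  rewrite vE hm add1n; congr _.+1; apply: eq_count => i /=.
  by rewrite leq_subRL.
rewrite !offS.
have -> : (h.+1 < m + offset mu (vert_of mu (h - m)).+1) = ((h - m).+1 < offset mu (vert_of mu (h - m)).+1).
  by apply/idP/idP; move: hm; clear; lia.
by case: ifP => // _; rewrite addnS subnKC.
Qed.

Lemma rot_lt mu h : h < sumn mu -> Defs.rot mu h < sumn mu.
Proof.
elim: mu h => // m mu IH h /=; rewrite rot_cons; case: (ltnP h m) => hm H.
  by case: ifP => hm'; move: hm hm'; clear; lia.
by rewrite ltn_add2l IH //; move: hm H; clear; lia.
Qed.

Section Transport.
Variable T : finType.
Implicit Types (s e : {perm T}) (L : seq (seq T)).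

Lemma connect_embed (U : finType) (f : U -> T) (r : rel T) (r0 : rel U) :
  injective f -> (forall a b, r (f a) (f b) = r0 a b) ->
  (forall a y, r (f a) y -> exists b, y = f b) ->
  forall a b, connect r (f a) (f b) = connect r0 a b.
Proof.
move=> fI rE rC a b; apply/idP/idP.
- move=> H.
  have [b' E ab'] : exists2 b', f b = f b' & connect r0 a b'.
    case/connectP: H => p; elim: p a => [|c p IH] a /=; first by move=> _ ->; exists a.
    case/andP=> ac; have [c' cE] := rC _ _ ac; rewrite cE in ac * => pp lE.
    by have [b' bE cb'] := IH _ pp lE; exists b' => //; apply: connect_trans cb'; apply: connect1; rewrite -rE.
  by rewrite (fI _ _ E).
- move=> H; apply: (connect_ind_closed (P := fun b => connect r (f a) (f b))) H _ => // u v fu uv.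
  by apply: connect_trans fu (connect1 _); rewrite rE.
Qed.

(** In the order of [flatten L] each cycle occupies a block, and the shift inside a block with
    return to its start is [s]. *)
Lemma rot_rotsys s L x0 h : uniq (flatten L) -> all (fcycle s) L -> h < size (flatten L) ->
  nth x0 (flatten L) (Defs.rot (shape L) h) = s (nth x0 (flatten L) h).
Proof.
elim: L h => // l L IH h /=; rewrite cat_uniq size_cat => /and3P[Ul _ UL] /andP[Cl CL] hL.
rewrite rot_cons !nth_cat; case: (ltnP h (size l)) => hl; last first.
  by rewrite -addnBAC // subnn add0n ltnNge leq_addr /= IH //; move: hL hl; clear; lia.
have xl : nth x0 l h \in l by rewrite mem_nth.
rewrite -(nextE Cl xl) next_nth xl index_uniq //.
(* At the last entry [next] returns to the head of the list, since that head [y] is the default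
   value of its [nth]. *)
case: l hl {xl Cl Ul hL} => // y l hl; case: (ltnP h.+1 (size (y :: l))) => hl'.
  by rewrite /= hl' (set_nth_default y).
by rewrite /= nth_default.
Qed.

(** All points of the support are darts here. [f] numbers them in the order of the lists, and
    conjugation by [f] carries the involutions to the finite functions of the encoding. *)
Lemma card_cellular_maps s L g : rotsys s L -> [::] \notin L -> L != [::] ->
  #|maps (supp L) s (supp L) g| = #|cellular_maps g (shape L)|.
Proof.
move=> sL L0 Lne; have [U C F0] := sL; have sA := rotsys_on sL.
set N := sumn (shape L); have NE : size (flatten L) = N by rewrite size_flatten.
have [x0 x0L] : exists x0, x0 \in flatten L.
  case: L L0 Lne {sL U C F0 sA N NE} => // -[//|x l] L _ _.
  by exists x; rewrite /= inE eqxx.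
have N0 : 0 < N by rewrite -NE; case: (flatten L) x0L.
pose f (h : 'I_N) := nth x0 (flatten L) h.
pose fi y : 'I_N := insubd (Ordinal N0) (index y (flatten L)).
have fA h : f h \in supp L by rewrite inE mem_nth // NE.
have fK : cancel f fi by move=> h; apply: val_inj; rewrite val_insubd index_uniq ?NE ?ltn_ord.
have fiK y : y \in supp L -> f (fi y) = y.
  rewrite inE => yL; have yN : index y (flatten L) < N by rewrite -NE index_mem.
  by rewrite /f /fi val_insubd yN nth_index.
have fI : injective f := can_inj fK.
have fs h : f (sigma_ord h) = s (f h).
  by rewrite /f /sigma_ord val_insubd rot_lt ?ltn_ord // (rot_rotsys _ U C) // NE.
have suppE : supp L = f @: 'I_N.
  apply/setP => y; apply/idP/imsetP => [yL|[h _ ->//]]; by exists (fi y); rewrite ?fiK.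
have cardA : #|supp L| = N by rewrite suppE card_imset // card_ord.
pose F e := [ffun h => fi (e (f h))] : {ffun 'I_N -> 'I_N}.
have FE e h : perm_on (supp L) e -> f (F e h) = e (f h).
  by move=> eA; rewrite ffunE fiK // perm_closed.
have key e : perm_on (supp L) e -> (F e \in cellular_maps g (shape L)) = (e \in maps (supp L) s (supp L) g).
  move=> eA; rewrite in_set in_maps [e \in involutions _]in_set -!andbA; congr [&& _, _, _ & _].
  - apply/forallP/forallP => H x.
      case: (boolP (x \in supp L)) => xL; last by rewrite !(out_perm eA).
      by rewrite -(fiK x xL) -!FE // (eqP (H _)).
    by rewrite -(inj_eq fI) !FE // H.
  - apply/forallP/forallP => H x.
      case: (boolP (x \in supp L)) => xL; last by rewrite (out_perm eA) // eqxx.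
      by rewrite -(fiK x xL) -FE // (inj_eq fI) H.
    by rewrite -(inj_eq fI) FE // (eqP (H _)).
  - have cE : forall a b, connect (gen_rel s e) (f a) (f b)
       = connect [rel a b | (b == sigma_ord a) || (b == F e a)] a b.
      apply: connect_embed => // [a b|a y]; first by rewrite /gen_rel /= -fs -FE // !(inj_eq fI).
      by case/orP=> /eqP->; [exists (sigma_ord a)|exists (F e a); rewrite FE].
    apply/forallP/connP => [H x y xL yL|H x].
      rewrite -(fiK x xL) -(fiK y yL) cE.
      exact: (forallP (H _) _).
    by apply/forallP => z; rewrite -cE; apply: H.
  - have esA : perm_on (supp L) (e * s)%g by apply: perm_onM.
    have cycE : #|porbit (e * s) @: supp L| = fcard (fun h => sigma_ord (F e h)) 'I_N.
      have -> : porbit (e * s) @: supp L = (porbit (e * s) \o f) @: 'I_N.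
        apply/setP => X; apply/imsetP/imsetP => -[y yL ->]; last by exists (f y).
        by exists (fi y); rewrite //= fiK.
      symmetry; apply: n_comp_kernel => a b /=.
      rewrite eq_porbit_mem porbit_sym mem_porbit_fconnect.
      apply: (connect_embed (r := frel (e * s)%g)) => // [c d|c y] /=; rewrite permM -FE // -fs.
        by rewrite (inj_eq fI).
      by move/eqP<-; exists (sigma_ord (F e c)).
    rewrite /euler (cyc_on esA) (rotsys_cyc sL L0) cardA cycE size_map.
    rewrite -/N [fcard _ predT](_ : _ = fcard (fun h => sigma_ord (F e h)) 'I_N); last exact: eq_n_comp_r.
    by move: (fcard _ _) => k; apply/eqP/eqP; clear; lia.
rewrite -(card_in_imset (f := F)); last first.
  move=> e e'; rewrite !in_maps => /and3P[/involutions_on eA _ _] /and3P[/involutions_on eA' _ _] /ffunP E.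
  apply/permP => x; case: (boolP (x \in supp L)) => xL.
    by rewrite -(fiK x xL) -!FE ?E // ?eA ?eA'.
  by rewrite (out_perm (eA _ (subxx _))) // (out_perm (eA' _ (subxx _))).
apply: eq_card => e0; apply/imsetP/idP.
  by case=> e eM ->; rewrite key //; move: eM; rewrite in_maps => /and3P[/involutions_on-> //].
move=> e0C; have e0K h : e0 (e0 h) = h.
  by move: e0C; rewrite in_set => /and4P[/forallP/(_ h)/eqP].
(* The inverse of [F]: [e0] is carried back along [f], and every point outside the support is
   fixed. *)
pose E y := if y \in supp L then f (e0 (fi y)) else y.
have EK : involutive E.
  move=> y; rewrite /E; case: (boolP (y \in supp L)) => yL; last by rewrite (negPf yL).
  by rewrite fA fK e0K fiK.
pose e := perm (inv_inj EK).
have eA : perm_on (supp L) e.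
  by apply/subsetP => y; rewrite inE permE /E; apply: contraR => /negPf->.
have FeE : F e = e0 by apply/ffunP => h; rewrite ffunE permE /E fA !fK.
by exists e => //; rewrite -key // FeE.
Qed.

Lemma supp_head_D1 x a L : uniq (flatten ((x :: a) :: L)) -> supp ((x :: a) :: L) :\ x = supp (a :: L).
Proof.
case/andP=> xL _; apply/setP => y; rewrite !inE /=; case: eqP => [->|] //=.
by symmetry; apply/negbTE.
Qed.

Lemma head_notin_darts x a L : uniq (flatten L) -> x :: a \in L -> x \notin darts L.
Proof.
move=> U xL; have P := perm_to_rem xL.
rewrite (darts_perm P) inE /= mem_cat negb_or.
move: U; rewrite (perm_uniq (perm_flatten P)) /= mem_cat negb_or => /andP[/andP[-> /= xr] _].
by apply: contra xr => xr; have := subsetP (sub_darts (rem (x :: a) L)) x; rewrite !inE; apply.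
Qed.

(** The heads in [L2] are deleted one at a time, the list just treated passing into [L1]. A list
    with at least two entries does not become empty. *)
Lemma maps_unmark s (L1 L2 : seq (seq T)) (D : {set T}) g :
  rotsys s (L1 ++ L2) -> all (fun l => 1 < size l) L2 ->
  (forall x a, x :: a \in L2 -> x \notin D) ->
  exists2 s', rotsys s' (L1 ++ map behead L2) &
    maps (supp (L1 ++ L2)) s D g = maps (supp (L1 ++ map behead L2)) s' D g.
Proof.
elim: L2 L1 s => [|l L2 IH] L1 s sL; first by move=> _ _; exists s.
move=> /= /andP[l1 S2] H; case: l l1 sL H => // x a a1 sL H.
have a0 : a != [::] by case: (a) a1.
have P1 : perm_eq (L1 ++ (x :: a) :: L2) ((x :: a) :: L1 ++ L2) by rewrite -cat1s perm_catCA.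
have sL1 := rotsys_perm P1 sL.
have P2 : perm_eq (a :: L1 ++ L2) (rcons L1 a ++ L2) by rewrite cat_rcons -[a :: L2]cat1s -cat1s perm_catCA.
have [||s' sL' E] := IH (rcons L1 a) (del x s) _ S2.
- exact: rotsys_perm P2 (rotsys_del sL1 a0).
- by move=> y b yb; apply: (H y b); rewrite inE yb orbT.
exists s'; first by rewrite -cat_rcons.
rewrite -[L1 ++ a :: _]cat_rcons -E (supp_perm P1) (@maps_del _ _ _ _ _ x).
- by rewrite supp_head_D1 ?(supp_perm P2) //; case: sL1.
- by rewrite inE /= inE eqxx.
- exact: rotsys_on.
- by apply: (H x a); rewrite inE eqxx.
- exact: rotsys_head_move sL1 a0.
Qed.

Lemma card_maps_Catalan s L g : rotsys s L -> [::] \notin L -> L != [::] ->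
  #|maps (supp L) s (darts L) g| = Catalan g [seq (size l).-1 | l <- L].
Proof.
move=> sL L0 Lne; rewrite /Catalan; case: eqP => mu0.
  (* A single vertex of degree 0: the lone marker carries only the identity, which has genus 0. *)
  case: L mu0 sL L0 Lne => [//|l [|//]] [l1].
  case: l l1 => [//|m [|//]] _ sL _ _.
  have D0 : darts [:: [:: m]] = set0 by apply/setP => x; rewrite !inE.
  have s1 : s = 1%g.
    apply: (rotsys_inj sL); split=> //= [|x _]; last by rewrite perm1.
    by rewrite perm1 eqxx.
  have I0 e : (e \in involutions (set0 : {set T})) = (e == 1%g).
    apply/involutionsP/eqP => [[_ H]|->]; last by split=> x; rewrite !perm1 // eqxx inE.
    by apply/permP => x; apply/eqP; rewrite perm1 -[_ == _]negbK H inE.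
  have S1 : supp [:: [:: m]] = [set m] by apply/setP => x; rewrite !inE.
  have cT : #|~: [set m]|.+1 = #|T| by have := cardsC [set m]; rewrite cards1; lia.
  have M e : (e \in maps (supp [:: [:: m]]) s (darts [:: [:: m]]) g) = (e == 1%g) && (g == 0).
    rewrite in_maps D0 I0; case: eqP => //= ->; rewrite /euler s1 mul1g cyc1 S1 cT cards0.
    have -> : conn [set m] (1%g : {perm T}) (1%g : {perm T}).
      by apply/connP => x y /set1P-> /set1P->.
    by apply/eqP/eqP; clear; lia.
  case: eqP M => gE M.
    transitivity #|[set (1%g : {perm T})]|; last exact: cards1.
    by apply: eq_card => e; rewrite M andbT inE.
  by apply: eq_card0 => e; rewrite M andbF.
case: ifP => [|/negbT].
  (* A vertex of degree 0 among others: its marker is fixed by both permutations, so it is joined to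
     no other point. *)
  rewrite -size_eq0 size_map size_eq0 (negPf Lne) /= => /mapP[l lL l1].
  case: l lL l1 => [/(negP L0)//|m [|//]] mL _.
  apply: eq_card0 => e; rewrite in_maps; apply/and3P => -[eI /connP cA _].
  have [U C _] := sL.
  have sm : s m = m by have := allP C _ mL; rewrite /= andbT => /eqP.
  have em : e m = m by apply: (involutions_fix eI); apply: head_notin_darts mL.
  have P := perm_to_rem mL; set R := rem _ L in P.
  have [y yA ym] : exists2 y, y \in supp L & y != m.
    rewrite (supp_perm P); move: U; rewrite (perm_uniq (perm_flatten P)).
    have R0 : [::] \notin R by apply: contra L0; exact: mem_rem.
    case: R P R0 => [P|[//|y b] R _ _] /=.
      by case: mu0; exact: (perm_small_eq _ (perm_map (fun l : seq T => (size l).-1) P)).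
    rewrite !inE negb_or eq_sym => /andP[/andP[ym _] _].
    by exists y => //; rewrite !inE eqxx orbT.
  have mA : m \in supp L by rewrite inE; apply/flattenP; exists [:: m] => //; rewrite inE.
  case/eqP: ym; apply/eqP; rewrite eq_sym.
  apply: (connect_ind_closed (P := fun z => m == z)) (cA m y mA yA) _ => // u v /eqP<-.
  by case/orP=> /eqP->; rewrite ?sm ?em.
rewrite negb_or => /andP[_ mu1].
(* Every degree is positive, so each marker shares its cycle with a dart and all markers can be
   deleted. *)
have S2 : all (fun l => 1 < size l) L.
  apply/allP => l lL; rewrite ltnNge; apply: contra mu1 => l1.
  by apply/mapP; exists l => //; case: (l) l1 => [|? []].
have [U _ _] := sL.
have [s' sL' E] := maps_unmark (L1 := [::]) g sL S2 (fun x a => head_notin_darts U).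
rewrite E /= [darts L]/(supp (map behead L)) (card_cellular_maps _ sL').
- by congr #|pred_of_set (cellular_maps g _)|; rewrite /shape -map_comp; apply: eq_map => l /=; rewrite size_behead.
- apply/negP => /mapP[l lL lE]; move: (allP S2 l lL); case: (l) lE => [|? [|]] //.
- by rewrite -size_eq0 size_map size_eq0.
Qed.

End Transport.

(** * The two sums of the recursion, according to the partner of the first dart *)

Section Recursion.
Variable T : finType.
Implicit Types (s p q e : {perm T}) (u v w : seq T) (L R : seq (seq T)).

Local Notation degrees L := [seq (size l).-1 | l <- L].

Lemma supp_catC u v L : supp ((u ++ v) :: L) = supp ((v ++ u) :: L).
Proof. by apply/setP => y; rewrite !inE /= !mem_cat [(y \in u) || _]orbC. Qed.

Lemma maps_rotsys_del s x u L (D : {set T}) g :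
  rotsys s ((x :: u) :: L) -> u != [::] -> x \notin D ->
  maps (supp ((x :: u) :: L)) s D g = maps (supp (u :: L)) (del x s) D g.
Proof.
move=> sL u0 xD; rewrite (@maps_del _ _ _ _ _ x) ?supp_head_D1 //.
- by case: sL.
- by rewrite inE /= inE eqxx.
- exact: rotsys_on.
- exact: rotsys_head_move sL u0.
Qed.

(** The cycle is first rotated so that [x] is its head; [D] is a separate argument and does not
    change with the head. *)
Lemma maps_rotsys_del_mid s x u v L (D : {set T}) g :
  rotsys s ((u ++ x :: v) :: L) -> v ++ u != [::] -> x \notin D ->
  rotsys (del x s) ((v ++ u) :: L) /\
  maps (supp ((u ++ x :: v) :: L)) s D g = maps (supp ((v ++ u) :: L)) (del x s) D g.
Proof.
move=> /rotsys_catC; rewrite cat_cons => sL vu xD; rewrite supp_catC cat_cons.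
by split; [exact: rotsys_del|exact: maps_rotsys_del].
Qed.

Lemma uniq_darts L : uniq (flatten L) -> uniq (flatten (map behead L)).
Proof.
elim: L => //= l L IH; rewrite !cat_uniq => /and3P[Ul /hasPn D /IH->].
rewrite andbT; apply/andP; split; first by case: l Ul {D} => //= x l /andP[].
apply/hasPn => x xL; apply: contra (D x _); first exact: mem_behead.
by have := subsetP (sub_darts L) x; rewrite !inE; apply.
Qed.

Lemma darts_D2 L L' x h : uniq (flatten L) ->
  perm_eq (flatten (map behead L)) (x :: h :: flatten (map behead L')) ->
  darts L :\ x :\ h = darts L'.
Proof.
move=> /uniq_darts U P; rewrite (perm_uniq P) /= in U; case/and3P: U => xL hL _.
apply/setP => y; rewrite !in_setD1 2!in_set (perm_mem P) !inE; move: xL; rewrite inE negb_or => /andP[_ xL].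
have [->|_] := eqVneq y h; first by rewrite (negPf hL).
by have [->|_] := eqVneq y x; first by rewrite (negPf xL).
Qed.

Lemma rotsys_connect s q L l x y : rotsys s L -> l \in L -> x \in l -> y \in l ->
  connect (gen_rel s q) x y.
Proof.
move=> sL lL xl yl; have : y \in porbit s x by rewrite (rotsys_porbit sL lL xl) inE.
by rewrite mem_porbit_fconnect; apply: fconnect_gen_rel; exact: gen_rel_l.
Qed.

Lemma CatalanZ_pred g mu :
  CatalanZ (Posz g - 1)%R mu = if g is g'.+1 then Catalan g' mu else 0.
Proof.
case: g => [//|g]; have -> : (Posz g.+1 - 1)%R = Posz g; last by [].
by rewrite -addn1 PoszD GRing.addrK.
Qed.

(** Maps are sorted by the partner of the dart [x], which is another dart of the first vertex or a
    dart of a different one. *)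
Lemma card_maps_arrow s M x w R g :
  rotsys s ((M :: x :: w) :: R) ->
  let L := (M :: x :: w) :: R in
  #|maps (supp L) s (darts L) g| =
  \sum_(h <- w ++ flatten (map behead R))
     #|[set e in maps (supp L) s (darts L) g | e x == h]|.
Proof.
move=> sL L; have [U _ _] := sL; have := uniq_darts U; rewrite /= => /andP[xw Uw].
rewrite big_uniq //= -sum1_card (partition_big (fun e : {perm T} => e x) (mem (w ++ flatten (map behead R)))) /=.
  apply: eq_bigr => h _; rewrite -sum1_card; apply: eq_bigl => e; by rewrite in_set.
move=> e; rewrite in_maps => /and3P[/involutionsP[ee eD] _ _].
have xD : x \in darts L by rewrite inE /= inE eqxx.
have exx : e x != x by rewrite eD.
have : e x \in darts L by rewrite -eD ee eq_sym.
by rewrite inE /= inE (negPf exx).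
Qed.

(** The merged cycle runs [x], [v], [m], [u], [h], [w], [M]. Deleting [x], [m] and [h] leaves the
    marker [M] and the darts [v], [u], [w]: two darts fewer than the two vertices had together. *)
Lemma card_maps_merge_Catalan s M x w R1 m u h v R2 g :
  let L := (M :: x :: w) :: R1 ++ (m :: u ++ h :: v) :: R2 in
  rotsys s L -> [::] \notin L ->
  #|[set e in maps (supp L) s (darts L) g | e x == h]|
    = Catalan g ((size w + (size u + size v)) :: degrees (R1 ++ R2)).
Proof.
move=> L sL L0; have [U _ _] := sL.
have PL : perm_eq L (([:: M] ++ x :: w) :: (m :: u ++ h :: v) :: R1 ++ R2).
  by rewrite /L perm_cons -cat1s perm_catCA.
have sL1 := rotsys_catC (rotsys_perm PL sL).
have PC (a b : seq T) R : perm_eq (a :: b :: R) (b :: a :: R) by rewrite -[_ :: R in X in perm_eq X _]cat1s -cat1s perm_catCA.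
have := rotsys_perm (PC _ _ _) sL1; rewrite -cat_cons => /rotsys_catC /(rotsys_perm (PC _ _ _)) sL2.
have SL : supp L = supp ((x :: w ++ [:: M]) :: (h :: v ++ m :: u) :: R1 ++ R2).
  rewrite (supp_perm PL); apply/setP => y; rewrite !inE /= !(mem_cat, inE).
  by do !case: (_ == _) => //=; do !case: (_ \in _) => //=.
have xD : x \in darts L by rewrite inE /= inE eqxx.
have hD : h \in darts L.
  by rewrite (darts_perm PL) inE /= !(mem_cat, inE) eqxx !orbT.
have xh : x \notin porbit s h.
  have hL2 : h :: v ++ m :: u \in (x :: w ++ [:: M]) :: (h :: v ++ m :: u) :: R1 ++ R2.
    by rewrite !inE eqxx orbT.
  rewrite (rotsys_porbit sL2 hL2) ?mem_head // in_set.
  case: sL2 => /= /andP[xU _] _ _; apply: contra xU => xl.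
  by rewrite mem_cat -[h :: _]/((h :: v ++ m :: u) ++ flatten (R1 ++ R2)) [X in _ || X]mem_cat xl orbT.
rewrite card_maps_merge // SL; set p := (_ * s)%g; set D' := _ :\ _ :\ _.
have sp := rotsys_merge sL2; rewrite -/p in sp.
set R' := R1 ++ R2 in sp *.
pose L' := (M :: v ++ u ++ w) :: R'.
have D'E : D' = darts L'.
  apply: darts_D2 => //; apply: (perm_trans (perm_flatten (perm_map _ PL))).
  by apply/seq.permP => Q; rewrite /= -/R' !count_cat /=; clear; lia.
have [Up _ _] := sp.
have xD' : x \notin D' by rewrite !inE eqxx andbF.
have hD' : h \notin D' by rewrite !inE eqxx.
have mD' : m \notin D'.
  have : m \notin darts L by apply: (head_notin_darts U (a := u ++ h :: v)); rewrite !(inE, mem_cat) eqxx !orbT.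
  by rewrite !in_setD1; apply: contra => /and3P[].
have SL' : supp ((x :: w ++ [:: M]) :: (h :: v ++ m :: u) :: R') = supp ((x :: (v ++ m :: u) ++ h :: w ++ [:: M]) :: R').
  apply/setP => y; rewrite !inE /= !(mem_cat, inE).
  by do !case: (_ == _) => //=; do !case: (_ \in _) => //=.
have ne (a b : seq T) y : a ++ y :: b != [::] by case: a.
rewrite SL' maps_rotsys_del //.
have := rotsys_del sp (ne _ _ _); set p1 := del x p; rewrite -!catA /= => sp1.
have [|sp2 ->] := maps_rotsys_del_mid g sp1 _ mD'; first by case: (u).
move: sp2; rewrite -catA cat_cons => sp2.
have [|sp3 ->] := maps_rotsys_del_mid g sp2 _ hD'; first by case: (w).
move: sp3; rewrite -!catA /= => /rotsys_catC sp3.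
rewrite supp_catC D'E [(M :: _) ++ _]cat_cons -catA; rewrite cat_cons -catA in sp3.
rewrite (card_maps_Catalan _ sp3) //=.
- by congr (Catalan g (_ :: _)); rewrite !size_cat; clear; lia.
- rewrite inE /=; apply: contra L0; rewrite /L !(inE, mem_cat) => /orP[]->; by rewrite ?orbT.
Qed.

(** Every other vertex lies wholly in the component of [h] or in that of [z]. The set [I] records
    the former, and for each [I] the count is a product. *)
Lemma card_bimaps_Catalan p h u z v R (rest : seq nat) g :
  let L := (h :: u) :: (z :: v) :: R in
  rotsys p L -> [::] \notin R -> degrees R = rest ->
  #|bimaps (supp L) p (darts L) z h g| =
  \sum_(g1 < g.+1) \sum_(I : {set 'I_(size rest)})
     Catalan g1 (size u :: [seq nth 0 rest (nat_of_ord i) | i <- enum I])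
     * Catalan (g - g1) (size v :: [seq nth 0 rest (nat_of_ord i) | i <- enum (~: I)]).
Proof.
move=> L pL R0 Rrest.
have sR : size R = size rest by rewrite -Rrest size_map.
have restN k : k < size rest -> nth 0 rest k = (size (nth [::] R k)).-1.
  by move=> kR; rewrite -Rrest (nth_map [::]) // sR.
pose sub (J : {set 'I_(size rest)}) := [seq nth [::] R (nat_of_ord i) | i <- enum J].
have subR J l : l \in sub J -> l \in R.
  by case/mapP=> i _ ->; rewrite mem_nth // sR.
have subNil J y a : y :: a != [::] -> [::] \notin (y :: a) :: sub J.
  by move=> _; rewrite inE /=; apply: contra R0; exact: subR.
have subDeg J y (a : seq T) : degrees ((y :: a) :: sub J) = size a :: [seq nth 0 rest (nat_of_ord i) | i <- enum J].
  rewrite /= /sub -map_comp; congr cons; apply: eq_map => i /=.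
  by rewrite restN.
have subP I : perm_eq L (((h :: u) :: sub I) ++ ((z :: v) :: sub (~: I))).
  have H : perm_eq R (sub I ++ sub (~: I)).
    rewrite /sub -map_cat -{1}(mkseq_nth [::] R) /mkseq sR -val_enum_ord -map_comp.
    apply: perm_map; apply: uniq_perm; first exact: enum_uniq.
      rewrite cat_uniq !enum_uniq andbT; apply/hasPn => i; rewrite !mem_enum inE //.
    by move=> i; rewrite mem_cat !mem_enum !inE orbN.
  apply/seq.permP => Q; rewrite /= count_cat /= (seq.permP H) count_cat.
  by congr (_ + _); rewrite addnCA.
(* One point of each cycle decides on which side the vertex lies; the cycles are nonempty, so the
   default [z] is never taken. *)
pose hd (i : 'I_(size rest)) := head z (nth [::] R i).
have hdR i : hd i \in nth [::] R i.
  rewrite /hd; case E : (nth [::] R i) => [|y a] /=; last by rewrite inE eqxx.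
  by case/negP: R0; rewrite -E mem_nth // sR.
pose Iof q := [set i | connect (gen_rel p q) h (hd i)].
rewrite exchange_big -sum1_card (partition_big Iof predT) //=.
apply: eq_bigr => I _.
set L1 := (h :: u) :: sub I; set L2 := (z :: v) :: sub (~: I).
have [U _ _] := pL.
have UI : uniq (flatten (L1 ++ L2)) by rewrite -(perm_uniq (perm_flatten (subP I))).
have [U1 dis U2] : [/\ uniq (flatten L1), {in flatten L2, forall x, x \notin flatten L1} & uniq (flatten L2)].
  by move: UI; rewrite flatten_cat cat_uniq => /and3P[? /hasPn ? ?].
(* For a given [I], [p] is the product of the rotations of the two sides, because the cycles
   determine a rotation. *)
have [p1 pL1] := rotsys_exists U1; have [p2 pL2] := rotsys_exists U2.
have pE : p = (p1 * p2)%g.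
  by apply: rotsys_inj (rotsys_mul UI pL1 pL2); exact: rotsys_perm (subP I) pL.
have dA : [disjoint supp L1 & supp L2].
  rewrite -setI_eq0; apply/eqP/setP => x; rewrite in_setI in_set0; apply/andP => -[].
  by rewrite !in_set => x1 /dis; rewrite x1.
have SE : supp L = supp L1 :|: supp L2.
  by rewrite (supp_perm (subP I)); apply/setP => x; rewrite in_setU !in_set flatten_cat mem_cat.
have DE : darts L = darts L1 :|: darts L2.
  by rewrite (darts_perm (subP I)); apply/setP => x; rewrite in_setU !in_set map_cat flatten_cat mem_cat.
have hA : h \in supp L1 by rewrite inE /= inE eqxx.
have zA : z \in supp L2 by rewrite inE /= inE eqxx.
have L1E x : x \in supp L1 = (x \in h :: u) || [exists i in I, x \in nth [::] R (nat_of_ord i)].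
  transitivity (x \in (h :: u) ++ flatten (sub I)); first by rewrite in_set.
  rewrite mem_cat; congr (_ || _).
  apply/flattenP/exists_inP => [[l /mapP[i iI ->] xi]|[i iI xi]].
    by exists i => //; rewrite -mem_enum.
  by exists (nth [::] R i) => //; apply/mapP; exists i; rewrite ?mem_enum.
have L2E x : x \in supp L2 = (x \in z :: v) || [exists i in ~: I, x \in nth [::] R (nat_of_ord i)].
  transitivity (x \in (z :: v) ++ flatten (sub (~: I))); first by rewrite in_set.
  rewrite mem_cat; congr (_ || _).
  apply/flattenP/exists_inP => [[l /mapP[i iI ->] xi]|[i iI xi]].
    by exists i => //; rewrite -mem_enum.
  by exists (nth [::] R i) => //; apply/mapP; exists i; rewrite ?mem_enum.
have RL (i : 'I_(size rest)) : nth [::] R (nat_of_ord i) \in L.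
  by rewrite /L 2!in_cons mem_nth ?orbT // sR.
have := card_bimaps_product dA (rotsys_on pL1) (rotsys_on pL2) (sub_darts L1) (sub_darts L2) g hA zA.
rewrite -pE -SE -DE => E.
transitivity (\sum_(g1 < g.+1) #|maps (supp L1) p1 (darts L1) g1| * #|maps (supp L2) p2 (darts L2) (g - g1)|); last first.
  by apply: eq_bigr => g1 _; rewrite (card_maps_Catalan _ pL1) ?subNil // (card_maps_Catalan _ pL2) ?subNil // !subDeg.
rewrite -E -sum1_card; apply: eq_bigl => q; rewrite in_set.
case: (boolP (q \in bimaps _ _ _ _ _ _)) => //= qB.
have zh : ~~ connect (gen_rel p q) z h by move: qB; rewrite in_bimaps => /and4P[].
have pqS := gen_rel_sym p q.
(* [Iof q = I] says that the component of [h] is [supp L1], which is the added condition of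
   [card_bimaps_product]. *)
apply/eqP/forall_inP => [IE y|H].
- have ccl l x : l \in L -> x \in l -> y \in l -> connect (gen_rel p q) h y = connect (gen_rel p q) h x.
    move=> lL xl yl; rewrite !(pqS h); apply: (same_connect pqS); exact: rotsys_connect pL lL yl xl.
  rewrite SE inE => /orP[y1|y2]; apply/eqP.
    rewrite y1; move: y1; rewrite L1E => /orP[yh|/exists_inP[i iI yi]].
      by rewrite (ccl (h :: u) h) ?connect0 ?mem_head.
    by rewrite (ccl _ (hd i) (RL i) (hdR i) yi); move: iI; rewrite -IE inE.
  rewrite (disjointFl dA y2); move: y2; rewrite L2E => /orP[yz|/exists_inP[i iI yi]].
    by rewrite (ccl (z :: v) z) ?mem_head ?inE ?eqxx ?orbT // pqS (negPf zh).
  by rewrite (ccl _ (hd i) (RL i) (hdR i) yi); apply/negbTE; move: iI; rewrite -IE !inE.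
- apply/setP => i; rewrite inE.
  have hdA : hd i \in supp L by rewrite inE; apply/flattenP; exists (nth [::] R i).
  rewrite (eqP (H _ hdA)); case: (boolP (i \in I)) => iI.
    by rewrite L1E; apply/orP; right; apply/exists_inP; exists i.
  apply: (disjointFl dA); rewrite L2E; apply/orP; right.
  by apply/exists_inP; exists i; rewrite ?inE.
Qed.

(** The first cycle falls into [x], [v], [M] and [h], [u]. Once [x] is deleted, [M] marks a vertex
    with darts [v], and [h], no longer a dart, marks one with darts [u]. *)
Lemma card_maps_split_Catalan s M x u h v R (rest : seq nat) g :
  let L := (M :: x :: u ++ h :: v) :: R in
  rotsys s L -> [::] \notin R -> degrees R = rest ->
  #|[set e in maps (supp L) s (darts L) g | e x == h]| =
  CatalanZ (Posz g - 1)%R (size u :: size v :: rest) +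
  \sum_(g1 < g.+1) \sum_(I : {set 'I_(size rest)})
     Catalan g1 (size u :: [seq nth 0 rest (nat_of_ord i) | i <- enum I])
     * Catalan (g - g1) (size v :: [seq nth 0 rest (nat_of_ord i) | i <- enum (~: I)]).
Proof.
move=> L sL R0 Rrest; have [U _ _] := sL.
have sL1 : rotsys s ((x :: u ++ h :: (v ++ [:: M])) :: R).
  by have := @rotsys_catC _ s [:: M] _ _ sL; rewrite /= -catA.
have SL1 : supp L = supp ((x :: u ++ h :: (v ++ [:: M])) :: R).
  by rewrite (supp_catC [:: M]) /= -catA.
have xD : x \in darts L by rewrite inE /= inE eqxx.
have hD : h \in darts L by rewrite inE /= !(inE, mem_cat) eqxx !orbT.
have xh : x != h.
  by case: sL1 => /= /andP[+ _] _ _; apply: contraNneq => ->; rewrite !(mem_cat, inE) eqxx !orbT.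
have xph : x \in porbit s h.
  rewrite (rotsys_porbit (l := M :: x :: u ++ h :: v) sL) ?in_set ?mem_head //.
    by rewrite !inE eqxx orbT.
  by rewrite !(mem_cat, inE) eqxx !orbT.
rewrite card_maps_split ?sub_darts ?(rotsys_on sL) //.
set p := (_ * s)%g; set D' := _ :\ _ :\ _.
have sp := rotsys_split sL1; rewrite -/p in sp.
pose L' := (h :: u) :: (M :: v) :: R.
have D'E : D' = darts L'.
  apply: darts_D2 => //.
  by apply/seq.permP => Q; rewrite /= !count_cat /=; clear; lia.
have xD' : x \notin D' by rewrite !inE eqxx andbF.
have v0 : v ++ [:: M] != [::] by case: (v).
have sp1 := rotsys_del sp v0; have px := rotsys_head_move sp v0.
have SL2 : supp L = supp ((x :: v ++ [:: M]) :: (h :: u) :: R).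
  rewrite SL1; apply/setP => y; rewrite !inE /= !(mem_cat, inE).
  by do !case: (_ == _) => //=; do !case: (_ \in _) => //=.
have PL' : perm_eq ((M :: v) :: (h :: u) :: R) L' by apply/seq.permP => Q /=; rewrite addnCA.
have spL' : rotsys (del x p) L' := rotsys_perm PL' (rotsys_catC sp1).
have SL' : supp ((v ++ [:: M]) :: (h :: u) :: R) = supp L' by rewrite supp_catC (supp_perm PL').
have L'0 : [::] \notin L' by rewrite !inE.
have xA : x \in supp L by apply: (subsetP (sub_darts L)).
congr (_ + _).
  rewrite CatalanZ_pred; case: g => // g'.
  rewrite SL2 maps_rotsys_del // SL' D'E (card_maps_Catalan _ spL') //=.
  by rewrite Rrest.
have Mx : M != x.
  by case/andP: U => + _; apply: contraNneq => ->; rewrite /= inE eqxx.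
have Mp : M \in porbit p x.
  by rewrite (rotsys_porbit (l := x :: v ++ [:: M]) sp) ?in_set ?mem_head // !(inE, mem_cat) eqxx !orbT.
have pA : perm_on (supp L) p by rewrite SL2; exact: rotsys_on.
(* [x] is deleted, and its component is represented by [M] from now on. *)
rewrite (bimaps_del (z := M) _ xA pA xD' px xh Mx Mp).
rewrite SL2 supp_head_D1 ?SL' ?D'E; last by case: sp.
exact: card_bimaps_Catalan.
Qed.

End Recursion.

(* mu = m1 :: rest, i.e. mu_1 = m1 and (mu_2, ..., mu_n) = rest, n >= 1;
   indices j of rest (0-based) correspond to 2..n. *)
Theorem theorem3p1 (g : nat) (m1 : nat) (rest : seq nat) :
  0 < m1 -> all (fun m => 0 < m) rest ->
  Catalan g (m1 :: rest) =
    \sum_(j < size rest)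
       nth 0 rest j * Catalan g ((m1 + nth 0 rest j - 2) :: (take j rest ++ drop j.+1 rest))
  + \sum_(a < m1.-1)
      ( CatalanZ (Posz g - 1)%R (nat_of_ord a :: (m1 - 2 - a) :: rest)
      + \sum_(g1 < g.+1) \sum_(I : {set 'I_(size rest)})
          Catalan g1 (nat_of_ord a :: [seq nth 0 rest (nat_of_ord i) | i <- enum I])
          * Catalan (g - g1) ((m1 - 2 - a) :: [seq nth 0 rest (nat_of_ord i) | i <- enum (~: I)])).
Proof.
move=> m1_gt0 rest_gt0.
(* Each cycle has one point more than the degree of its vertex, for the marker. *)
pose mu := map S (m1 :: rest); pose T : finType := 'I_(sumn mu).
pose L : seq (seq T) := reshape mu (enum T).
have shL : shape L = mu by apply: reshapeKl; rewrite size_enum_ord.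
have fL : flatten L = enum T by apply: reshapeKr; rewrite size_enum_ord.
have [s sL] : exists s, rotsys s L by apply: rotsys_exists; rewrite fL enum_uniq.
have degL : [seq (size l).-1 | l <- L] = m1 :: rest.
  by rewrite (map_comp predn size) -/(shape L) shL /mu -map_comp map_id_in.
have L0 : [::] \notin L.
  apply/negP => /(map_f size); rewrite -/(shape L) shL; by case/mapP.
clearbody L T; clear shL fL.
case: L sL degL L0 => [//|[|M [|x w]] R] sL [] // m1E restE L0.
  by move: m1_gt0; rewrite -m1E.
have wE : size w = m1.-1 by rewrite -m1E.
have R0 : [::] \notin R by move: L0; rewrite inE.
have -> : Catalan g (m1 :: rest) = #|maps (supp ((M :: x :: w) :: R)) s (darts ((M :: x :: w) :: R)) g|.
  by rewrite (card_maps_Catalan _ sL) //= -m1E -restE.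
(* The partner of [x] lies in another vertex, for the first sum, or in the first vertex, for the
   second. *)
rewrite card_maps_arrow // big_cat /= addnC; congr (_ + _); last first.
  (* A partner at position [a] of [w] has [a] darts before it and [m1 - 2 - a] after it: these are
     alpha and beta. *)
  rewrite (big_nth M) wE big_mkord; apply: eq_bigr => a _.
  have aw : a < size w by rewrite wE.
  have wA : w = take a w ++ nth M w a :: drop a.+1 w by rewrite -drop_nth // cat_take_drop.
  have sv : size (drop a.+1 w) = m1 - 2 - a by rewrite size_drop wE; clear; lia.
  have su : size (take a w) = a by rewrite size_takel // ltnW.
  have sL' : rotsys s ((M :: x :: take a w ++ nth M w a :: drop a.+1 w) :: R) by rewrite -wA.
  by have := card_maps_split_Catalan g sL' R0 restE; rewrite su sv -wA.
rewrite big_flatten big_map (big_nth [::]) /=.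
have sR : size R = size rest by rewrite -restE size_map.
rewrite sR big_mkord; apply: eq_bigr => j _.
have jR : j < size R by rewrite sR.
set l := nth [::] R j.
have restN k : k < size R -> nth 0 rest k = (size (nth [::] R k)).-1.
  by move=> kR; rewrite -restE (nth_map [::]).
have lE : size (behead l) = nth 0 rest j by rewrite restN // size_behead.
rewrite -lE; set C := Catalan g _.
(* The summand depends only on the vertex of [h], whose number of darts gives the factor
   [nth 0 rest j]. *)
transitivity (\sum_(h <- behead l) C); last by rewrite big_const_seq count_predT iter_addn_0 mulnC.
apply: eq_big_seq => h hl.
have RE : R = take j R ++ l :: drop j.+1 R by rewrite -drop_nth // cat_take_drop.
have [m [u [v lE']]] : exists m u v, l = m :: u ++ h :: v.
  by case: (l) hl => [//|m b] /= /splitPr[u v]; exists m, u, v.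
have lsz : size (behead l) = (size u + size v).+1 by rewrite lE' /= size_cat addnS.
rewrite {}RE {}lE' in sL L0 lE *; rewrite (card_maps_merge_Catalan g sL L0) /C lsz.
rewrite map_cat map_take map_drop restE; congr (Catalan g (_ :: _)).
by rewrite -m1E addSn addnS subn2.
Qed.
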